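(* Let $R$ be a positively graded algebra over a field and $I$ a graded ideal of $R$. Let $f$ be a form in $R$ which is a non-zerodivisor of $R/I^t$ for all $t \ge 0$. Then (i) $\operatorname{depth} R/(I,f)^t$ is a non-increasing function of $t$ ($t\ge 1$); (ii) $\operatorname{reg} R/(I,f)^t - t\deg f$ is a non-decreasing function of $t$ ($t\ge 1$).
   Context: A positively graded algebra over a field $k$ is a finitely generated graded $k$-algebra $R=\bigoplus_{i\ge0}R_i$ with $R_0=k$; $\mathfrak m=\bigoplus_{i>0}R_i$ is its maximal homogeneous ideal. A form is a homogeneous element. For a finitely generated graded $R$-module $M$ with local cohomology modules $H^i_{\mathfrak m}(M)$, $\operatorname{depth} M := \min\{ i \mid H^i_{\mathfrak m}(M) \neq 0\}$ and $\operatorname{reg} M := \max\{i+j \mid H^i_{\mathfrak m}(M)_j \neq 0\}$. By the usual convention the zero module has depth $+\infty$ and regularity $-\infty$. $(I,f)=I+(f)$, and $(I,f)^t$ is its $t$-th power. $I^0=R$ (so the condition for $t=0$ is vacuous). *)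

(* Defs.v *)
From HB Require Import structures.
From mathcomp Require Import all_boot all_order all_algebra.
From mathcomp Require Import generic_quotient ring_quotient finmap.
From mathcomp Require Import boolp classical_sets functions cardinality.
From mathcomp Require Import fsbigop constructive_ereal.

Set Implicit Arguments.
Unset Strict Implicit.
Unset Printing Implicit Defensive.

Import Order.TTheory GRing.Theory Num.Theory.

Local Open Scope classical_set_scope.
Local Open Scope ring_scope.

Lemma set_sum (V : zmodType) (K : set V) (T : Type) (s : seq T) (F : T -> V) :
  K 0 -> (forall u v, K u -> K v -> K (u + v)) -> (forall i, K (F i)) ->
  K (\sum_(i <- s) F i).
Proof. by move=> K0 KD KF; apply: (big_ind K). Qed.

Section Gradings.
Variables (I : choiceType) (V : zmodType).
Implicit Types (G : I -> set V) (c : I -> V) (v : V).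

(* [c] lists the homogeneous components of [v].  The support must be finite
   because a sum over [setT] with infinite support is 0 by convention. *)
Definition decomp G c v : Prop :=
  [/\ forall i, G i (c i), finite_set [set i | c i != 0]
    & v = \sum_(i \in [set: I]) c i].

Definition is_grading G : Prop :=
  (forall i, G i 0 /\ forall u v, G i u -> G i v -> G i (u - v)) /\
  (forall v, exists! c, decomp G c v).

Lemma decompP G c v : decomp G c v <->
  (forall i, G i (c i)) /\
  exists s : seq I,
    [/\ uniq s, forall i, i \notin s -> c i = 0 & v = \sum_(i <- s) c i].
Proof.
split=> [[Gc fc ->]|[Gc [s [us cs ->]]]].
  split=> //; exists (enum_fset (fset_set [set i | c i != 0])); split.
  - exact: fset_uniq.
  - by move=> i ni; apply/eqP/negP => /negP ci; case/negP: ni; rewrite in_fset_set // inE.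
  - rewrite -(@fsbig_widen I V 0 +%R [set i | c i != 0] setT) ?fsbig_finite//.
    by move=> i [_ /= /negP]; rewrite negbK => /eqP.
have sub : [set i | c i != 0] `<=` [set` s].
  by move=> i /=; apply: contraNT => /cs ->.
split=> //; first exact: sub_finite_set sub (finite_seq s).
rewrite fsbig_seq //; apply: fsbig_widen => // i [_ /= /negP]; exact: cs.
Qed.

Variables (G : I -> set V) (gG : is_grading G).

Lemma grad0 i : G i 0. Proof. by case: (gG.1 i). Qed.
Lemma gradB i u v : G i u -> G i v -> G i (u - v).
Proof. by case: (gG.1 i) => _; apply. Qed.
Lemma gradN i u : G i u -> G i (- u).
Proof. by rewrite -[- u]sub0r; apply: gradB; apply: grad0. Qed.
Lemma gradD i u v : G i u -> G i v -> G i (u + v).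
Proof. by move=> Gu Gv; rewrite -[v]opprK; apply/gradB/gradN. Qed.

Lemma decomp_uniq c c' v : decomp G c v -> decomp G c' v -> c = c'.
Proof.
by move=> d d'; case: (gG.2 v) => c0 [_ u]; rewrite -(u _ d) -(u _ d').
Qed.

Lemma decomp_uniq_val c u v : decomp G c u -> decomp G c v -> u = v.
Proof. by move=> [_ _ ->] [_ _ ->]. Qed.

Lemma decomp_ex v : exists c, decomp G c v.
Proof. by case: (gG.2 v) => c [d _]; exists c. Qed.

Lemma decomp_sum c v (s : seq I) : decomp G c v -> uniq s ->
  (forall i, i \notin s -> c i = 0) -> v = \sum_(i <- s) c i.
Proof.
move=> d us cs; apply: (decomp_uniq_val d).
by apply/decompP; split; [case: d|exists s].
Qed.

Lemma decomp_common c c' u v : decomp G c u -> decomp G c' v ->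
  exists s : seq I, [/\ uniq s, forall i, i \notin s -> c i = 0 /\ c' i = 0,
    u = \sum_(i <- s) c i & v = \sum_(i <- s) c' i].
Proof.
move=> du dv; have [_ [s [us cs _]]] := (decompP _ _ _).1 du.
have [_ [t [ut ct _]]] := (decompP _ _ _).1 dv.
have h i : i \notin undup (s ++ t) -> c i = 0 /\ c' i = 0.
  by rewrite mem_undup mem_cat negb_or => /andP[/cs ? /ct].
exists (undup (s ++ t)); split; rewrite ?undup_uniq //.
- by apply: decomp_sum du _ _; rewrite ?undup_uniq // => i /h[].
- by apply: decomp_sum dv _ _; rewrite ?undup_uniq // => i /h[].
Qed.

Lemma decompB c c' u v : decomp G c u -> decomp G c' v ->
  decomp G (fun i => c i - c' i) (u - v).
Proof.
move=> du dv; have [s [us cs eu ev]] := decomp_common du dv.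
apply/decompP; split=> [i|].
  by case: du => + _ _; case: dv => + _ _ => h' h; apply: gradB.
exists s; split=> // [i /cs[-> ->]|]; first by rewrite subr0.
by rewrite sumrB -eu -ev.
Qed.

Lemma decomp0 : decomp G (fun=> 0) 0.
Proof.
apply/decompP; split=> [i|]; first exact: grad0.
by exists [::]; split=> //; rewrite big_nil.
Qed.

Lemma decompD c c' u v : decomp G c u -> decomp G c' v ->
  decomp G (fun i => c i + c' i) (u + v).
Proof.
move=> du dv; rewrite -[v]opprK -[- v]sub0r.
have := decompB du (decompB decomp0 dv); congr decomp.
by apply: funext => i; rewrite sub0r opprK.
Qed.

Lemma decomp_homog i v : G i v -> decomp G (fun l => if l == i then v else 0) v.
Proof.
move=> Gv; apply/decompP; split=> [l|].
  by case: eqP => [->//|_]; apply: grad0.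
exists [:: i]; split=> // [l|]; last by rewrite big_seq1 eqxx.
by rewrite inE => /negbTE->.
Qed.

End Gradings.

Record posGradedAlg (k : fieldType) := PosGradedAlg {
  alg :> comAlgType k;
  deg : nat -> set alg;
  deg_grading : is_grading deg;
  degM : forall i j a b, deg i a -> deg j b -> deg (i + j)%N (a * b);
  deg_0 : deg 0%N = [set c%:A | c in [set: k]];
  alg_fg : exists s : seq alg, smallest (fun S : set alg =>
      [/\ S 1, forall (c : k) u v, S u -> S v -> S (c *: u + v)
        & forall u v, S u -> S v -> S (u * v)]) [set` s] = setT }.

Arguments deg {k} _ _ _.

Section GradedIdeals.
Context {k : fieldType}.
Implicit Type R : posGradedAlg k.

Definition is_ideal R (J : set R) : Prop :=
  J 0 /\ forall a u v, J u -> J v -> J (a * u + v).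

Definition is_homogeneous R (J : set R) : Prop :=
  forall r c, decomp (deg R) c r -> J r -> forall i, J (c i).

Record gradedIdeal R := GradedIdeal {
  ideal_set :> set R;
  ideal_ideal : is_ideal ideal_set;
  ideal_homog : is_homogeneous ideal_set }.

Section IdealTheory.
Variables (R : posGradedAlg k) (J : set R).
Hypothesis iJ : is_ideal J.

Lemma ideal0 : J 0. Proof. exact: iJ.1. Qed.
Lemma idealD u v : J u -> J v -> J (u + v).
Proof. by rewrite -{2}[u]mul1r; apply: iJ.2. Qed.
Lemma idealM a u : J u -> J (a * u).
Proof. by move=> Ju; rewrite -[_ * _]addr0; apply: iJ.2 Ju ideal0. Qed.
Lemma idealB u v : J u -> J v -> J (u - v).
Proof. by move=> Ju Jv; rewrite -mulN1r addrC; apply: iJ.2. Qed.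
Lemma ideal_sum (T : Type) (s : seq T) (F : T -> R) :
  (forall i, J (F i)) -> J (\sum_(i <- s) F i).
Proof.
move=> JF; apply: set_sum => //; [exact: ideal0|exact: idealD].
Qed.
End IdealTheory.

Lemma smallest_ideal R (S : set R) : is_ideal (smallest (@is_ideal R) S).
Proof.
split=> [J [iJ _]|a u v Ju Jv J [iJ SJ]]; first exact: ideal0.
by apply: iJ.2; [apply: Ju|apply: Jv].
Qed.

Let hcore R (J : set R) : set R :=
  [set r | exists2 c, decomp (deg R) c r & forall i, J (c i)].

Lemma hcore_ideal R (J : set R) : is_ideal J -> is_ideal (hcore J).
Proof.
move=> iJ.
have add u v : hcore J u -> hcore J v -> hcore J (u + v).
  move=> [c du Jc] [c' dv Jc']; exists (fun i => c i + c' i) => [|i].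
    exact (decompD (deg_grading R) du dv).
  exact: idealD.
have zero : hcore J 0.
  exists (fun=> 0) => [|i]; last exact: ideal0.
  exact (decomp0 (deg_grading R)).
have mulh p a u : deg R p a -> hcore J u -> hcore J (a * u).
  move=> da [c du Jc]; have [Gc [s [us cs ->]]] := (decompP _ _ _).1 du.
  rewrite mulr_sumr; apply: set_sum => // i.
  exists (fun l => if l == (p + i)%N then a * c i else 0).
    by apply: (decomp_homog (deg_grading R)); apply: degM.
  by move=> l; case: eqP => _; [apply: idealM|apply: ideal0].
split=> // a u v hu hv; apply: (add) => //.
have [c da] := decomp_ex (deg_grading R) a.
have [Gc [s [us cs ->]]] := (decompP _ _ _).1 da.
rewrite mulr_suml; apply: set_sum => // i; exact: mulh (Gc i) hu.
Qed.

Lemma hcore_homog R (J : set R) : J `<=` hcore J -> is_homogeneous J.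
Proof.
move=> Jh r c d /Jh[c' d' Jc'] i.
by rewrite (decomp_uniq (deg_grading R) d d').
Qed.

Lemma smallest_homog R (S : set R) : S `<=` hcore (smallest (@is_ideal R) S) ->
  is_homogeneous (smallest (@is_ideal R) S).
Proof.
move=> Sh; apply: hcore_homog => r Jr; apply: Jr; split=> //.
exact/hcore_ideal/smallest_ideal.
Qed.

Lemma unit_idealP R : is_ideal [set: R] /\ is_homogeneous [set: R].
Proof. by []. Qed.

Definition unit_ideal R : gradedIdeal R :=
  GradedIdeal (unit_idealP R).1 (unit_idealP R).2.

(* The direct sum of the [deg R i] with i > 0. *)
Definition irrelevant_set R : set R :=
  [set r | exists2 c, decomp (deg R) c r & c 0%N = 0].

Lemma irrelevant_hcore R : @irrelevant_set R `<=` hcore (@irrelevant_set R).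
Proof.
move=> r [c d c0]; exists c => // i; have [Gc _ _] := d.
exists (fun l => if l == i then c i else 0).
  exact: (decomp_homog (deg_grading R)).
by case: eqP => // <-.
Qed.

Lemma irrelevant_ideal_proof R : is_ideal (@irrelevant_set R).
Proof.
have add u v : @irrelevant_set R u -> @irrelevant_set R v ->
    @irrelevant_set R (u + v).
  move=> [c du c0] [c' dv c'0]; exists (fun i => c i + c' i).
    exact (decompD (deg_grading R) du dv).
  by rewrite c0 c'0 addr0.
have zero : @irrelevant_set R 0.
  by exists (fun=> 0) => //; exact (decomp0 (deg_grading R)).
split=> // a u v hu hv; apply: (add) => //.
have [c [Gc fc ->] c0] := hu.
have [b da] := decomp_ex (deg_grading R) a.
have [Gb [s [us bs ->]]] := (decompP _ _ _).1 da.
have [_ [t [ut ct ->]]] := (decompP (deg R) c _).1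
  (And3 Gc fc erefl).
rewrite mulr_suml; apply: set_sum => // i.
rewrite mulr_sumr; apply: set_sum => // j.
have [->|j0] := eqVneq j 0%N; first by rewrite c0 mulr0.
exists (fun l => if l == (i + j)%N then b i * c j else 0).
  by apply: (decomp_homog (deg_grading R)); apply: degM.
by case: j j0 => // j _; rewrite addnS.
Qed.

Definition irrelevant R : gradedIdeal R :=
  GradedIdeal (@irrelevant_ideal_proof R) (hcore_homog (@irrelevant_hcore R)).

(* The ideal of finite sums of products. *)
Definition mul_set R (I J : set R) : set R :=
  smallest (@is_ideal R) [set x | exists2 a, I a & exists2 b, J b & x = a * b].

Lemma mul_homog R (I J : gradedIdeal R) : is_homogeneous (mul_set I J).
Proof.
apply: smallest_homog => _ [a Ia [b Jb ->]].
have iK : is_ideal (hcore (mul_set I J)).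
  exact/hcore_ideal/smallest_ideal.
have [c da] := decomp_ex (deg_grading R) a.
have [e db] := decomp_ex (deg_grading R) b.
have [Gc [s [_ _ ->]]] := (decompP _ _ _).1 da.
have [Ge [t [_ _ ->]]] := (decompP _ _ _).1 db.
rewrite mulr_suml; apply: ideal_sum => // i.
rewrite mulr_sumr; apply: ideal_sum => // j.
exists (fun l => if l == (i + j)%N then c i * e j else 0).
  by apply: (decomp_homog (deg_grading R)); apply: degM.
move=> l; case: eqP => _; last exact: (ideal0 (smallest_ideal _)).
move=> K [_]; apply; exists (c i); first exact: ideal_homog da Ia i.
by exists (e j) => //; exact: ideal_homog db Jb j.
Qed.

Definition ideal_mul R (I J : gradedIdeal R) : gradedIdeal R :=
  GradedIdeal (smallest_ideal _) (@mul_homog R I J).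

Fixpoint ideal_pow R (I : gradedIdeal R) (t : nat) : gradedIdeal R :=
  if t is t'.+1 then ideal_mul I (ideal_pow I t') else unit_ideal R.

Definition add_set R (I J : set R) : set R :=
  [set x | exists2 a, I a & exists2 b, J b & x = a + b].

Lemma add_ideal R (I J : gradedIdeal R) : is_ideal (add_set I J).
Proof.
have [iI iJ] := (ideal_ideal I, ideal_ideal J); split.
  exists 0; first exact: ideal0.
  by exists 0; [exact: ideal0|rewrite addr0].
move=> r u v [a Ia [b Jb ->]] [a' Ia' [b' Jb' ->]].
exists (r * a + a'); first exact: iI.2.
exists (r * b + b'); first exact: iJ.2.
by rewrite mulrDr addrACA.
Qed.

Lemma add_homog R (I J : gradedIdeal R) : is_homogeneous (add_set I J).
Proof.
apply: hcore_homog => _ [a Ia [b Jb ->]].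
have [c da] := decomp_ex (deg_grading R) a.
have [e db] := decomp_ex (deg_grading R) b.
exists (fun i => c i + e i) => [|i].
  exact: (decompD (deg_grading R)).
exists (c i); first exact: ideal_homog da Ia i.
by exists (e i) => //; exact: ideal_homog db Jb i.
Qed.

Definition ideal_add R (I J : gradedIdeal R) : gradedIdeal R :=
  GradedIdeal (@add_ideal R I J) (@add_homog R I J).

Definition principal_set R (f : R) : set R := [set a * f | a in [set: R]].

Lemma principal_ideal R (f : R) : is_ideal (principal_set f).
Proof.
split=> [|r u v [a _ <-] [b _ <-]]; first by exists 0; rewrite ?mul0r.
by exists (r * a + b) => //; rewrite mulrDl mulrA.
Qed.

Lemma principal_homog R (f : R) (d : nat) (fd : deg R d f) :
  is_homogeneous (principal_set f).
Proof.
apply: hcore_homog => x [a _ <-].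
have iK : is_ideal (hcore (principal_set f)).
  exact/hcore_ideal/principal_ideal.
apply: idealM => //; exists (fun l => if l == d then f else 0).
  exact: (decomp_homog (deg_grading R)).
move=> l; case: eqP => _; first by exists 1; rewrite ?mul1r.
exact: (ideal0 (principal_ideal f)).
Qed.

(* The degree [d] only serves to show that the ideal is homogeneous. *)
Definition principal R (f : R) (d : nat) (fd : deg R d f) : gradedIdeal R :=
  GradedIdeal (principal_ideal f) (principal_homog fd).

End GradedIdeals.

Record gradedMod (k : fieldType) (R : posGradedAlg k) := GradedMod {
  mod_sort :> lmodType R;
  mdeg : int -> set mod_sort;
  mdeg_grading : is_grading mdeg;
  mdegZ : forall (i : nat) (j : int) (a : R) x,
    deg R i a -> mdeg j x -> mdeg (i%:Z + j) (a *: x) }.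

Section QuotientModule.
Context {k : fieldType} (R : posGradedAlg k) (J : gradedIdeal R).

Definition ideal_mem (r : R) : bool := `[< ideal_set J r >].

Lemma ideal_mem_closed : zmod_closed ideal_mem.
Proof.
split=> [|u v]; rewrite /in_mem /=; first by apply/asboolP; exact: (ideal0 (ideal_ideal J)).
move=> /asboolP Ju /asboolP Jv; apply/asboolP.
exact: (idealB (ideal_ideal J)).
Qed.
HB.instance Definition _ := GRing.isZmodClosed.Build R ideal_mem ideal_mem_closed.

Let ideal_pred : zmodClosed R := GRing.ZmodClosed.clone R ideal_mem _.

Definition residue := Quotient.quot ideal_pred.
HB.instance Definition _ := GRing.Zmodule.on residue.

Definition residue_class (r : R) : residue := \pi_residue%qT r.
Local Notation pi := residue_class.

Lemma residue_classB a b : pi (a - b) = pi a - pi b.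
Proof. exact: (raddfB \pi_residue%qT). Qed.

Lemma residue_classP x : exists r, x = pi r.
Proof. by exists (repr x); rewrite /pi reprK. Qed.

Lemma residue_class_eq a b : pi a = pi b <-> ideal_set J (a - b).
Proof.
have E : `[< ideal_set J (a - b) >] = (pi a == pi b).
  exact: (Quotient.idealrBE ideal_pred a b).
split=> [/eqP|/asboolP]; first by rewrite -E => /asboolP.
by rewrite E => /eqP.
Qed.

Definition residue_scale (a : R) (x : residue) : residue := pi (a * repr x).

Lemma residue_scaleE a b : residue_scale a (pi b) = pi (a * b).
Proof.
apply/residue_class_eq; rewrite -mulrBr.
apply: (idealM (ideal_ideal J)); apply/residue_class_eq.
by rewrite /pi reprK.
Qed.

Lemma residue_classD a b : pi (a + b) = pi a + pi b.
Proof. exact: (raddfD \pi_residue%qT). Qed.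

Lemma residue_scaleA a b x :
  residue_scale a (residue_scale b x) = residue_scale (a * b) x.
Proof.
by have [r ->] := residue_classP x; rewrite !residue_scaleE mulrA.
Qed.

Lemma residue_scale1 : left_id 1 residue_scale.
Proof.
by move=> x; have [r ->] := residue_classP x; rewrite residue_scaleE mul1r.
Qed.

Lemma residue_scaleDr : right_distributive residue_scale +%R.
Proof.
move=> a x y; have [r ->] := residue_classP x; have [s ->] := residue_classP y.
by rewrite -residue_classD !residue_scaleE mulrDr residue_classD.
Qed.

Lemma residue_scaleDl x : {morph residue_scale^~ x : a b / a + b}.
Proof.
move=> a b; have [r ->] := residue_classP x.
by rewrite !residue_scaleE mulrDl residue_classD.
Qed.

HB.instance Definition _ := GRing.Zmodule_isLmodule.Build R residue
  residue_scaleA residue_scale1 residue_scaleDr residue_scaleDl.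

(* [Negz n] is -(n+1): the quotient lives in nonnegative degrees. *)
Definition residue_deg (j : int) : set residue :=
  if j is Posz i then pi @` deg R i else [set 0].

Lemma residue_grading : is_grading residue_deg.
Proof.
have gR := deg_grading R; have iJ := ideal_ideal J.
have pi0 : pi 0 = 0 by rewrite -(subrr 0) residue_classB subrr.
have pisum (s : seq nat) F : pi (\sum_(i <- s) F i) = \sum_(i <- s) pi (F i).
  by elim/big_rec2: _ => // i x y _ <-; rewrite residue_classD.
split=> [[i|n]|v].
- split; first by exists 0 => //; apply: grad0 gR i.
  by move=> _ _ [a Ga <-] [b Gb <-]; exists (a - b);
    [exact: gradB|exact: residue_classB].
- by split=> // _ _ -> ->; rewrite subr0.
have [r ->] := residue_classP v.
have [c d] := decomp_ex gR r.
have [Gc [s [us cs er]]] := (decompP _ _ _).1 d.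
exists (fun j => if j is Posz i then pi (c i) else 0); split.
  apply/decompP; split=> [[i|n] //|]; first by exists (c i).
  exists (map Posz s); split.
  - by rewrite map_inj_uniq // => a b [].
  - move=> [i|n] // ni; rewrite cs //; apply: contra ni => si.
    by apply/mapP; exists i.
  - by rewrite big_map er pisum.
move=> e de; have [Ge [t [ut et er']]] := (decompP _ _ _).1 de.
have lift i : {b | deg R i b /\ pi b = e (Posz i) & e (Posz i) = 0 -> b = 0}.
  apply: cid2; have [e0|ne] := eqVneq (e (Posz i)) 0.
    by exists 0 => //; split; [exact: grad0 gR i|rewrite e0].
  have [b Gb eb] := Ge (Posz i); exists b => // e0.
  by rewrite e0 eqxx in ne.
pose b i := s2val (lift i).
have Gb i : deg R i (b i) by case: (s2valP (lift i)).
have eb i : pi (b i) = e (Posz i) by case: (s2valP (lift i)).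
have b0 i : e (Posz i) = 0 -> b i = 0 by exact: (s2valP' (lift i)).
pose t' := undup [seq absz j | j <- t].
have bt i : i \notin t' -> b i = 0.
  rewrite mem_undup => ni; apply/b0/et; apply: contra ni => ti.
  by apply/mapP; exists (Posz i).
have db : decomp (deg R) b (\sum_(i <- t') b i).
  by apply/decompP; split=> //; exists t'; rewrite undup_uniq.
have eneg n : e (Negz n) = 0 by exact: (Ge (Negz n)).
have piE : pi (\sum_(i <- t') b i) = pi r.
  rewrite pisum (eq_bigr (fun i => e (Posz i))) //.
  have -> : \sum_(i <- t') e (Posz i) = \sum_(j <- map Posz t') e j.
    by rewrite big_map.
  apply/esym/(decomp_sum de).
    by rewrite map_inj_uniq ?undup_uniq // => x y [].
  case=> // i ni; rewrite -eb bt //; apply: contra ni => ti.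
  by apply/mapP; exists i.
apply: funext => -[i|n]; last by rewrite eneg.
rewrite -eb; apply/esym/residue_class_eq.
by apply: (ideal_homog (decompB gR db d)); apply/residue_class_eq.
Qed.

Lemma residue_degZ (i : nat) (j : int) (a : R) (x : residue) :
  deg R i a -> residue_deg j x -> residue_deg (i%:Z + j) (a *: x).
Proof.
move=> da; case: j => [j [b db <-]|n ->].
  by exists (a * b); [exact: degM|rewrite -residue_scaleE].
rewrite scaler0; case: (i%:Z + _) => // l.
exists 0; first exact: grad0 (deg_grading R) l.
by rewrite -(subrr 0) residue_classB subrr.
Qed.

Definition quotient_mod : gradedMod R :=
  GradedMod residue_grading residue_degZ.

End QuotientModule.

Section LocalCohomology.
Context {k : fieldType} {R : posGradedAlg k}.

Definition is_graded_map (M N : gradedMod R) (f : M -> N) : Prop :=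
  forall j x, mdeg j x -> mdeg j (f x).

(* Injective objects of the category of graded modules and degree-preserving
   maps (often written *injective). *)
Definition is_injective (E : gradedMod R) : Prop :=
  forall (M N : gradedMod R) (u : {linear M -> N}) (f : {linear M -> E}),
    is_graded_map u -> injective u -> is_graded_map f ->
    exists2 g : {linear N -> E}, is_graded_map g & g \o u =1 f.

Record injectiveResolution (M : gradedMod R) := InjectiveResolution {
  res_mod : nat -> gradedMod R;
  res_aug : {linear M -> res_mod 0};
  res_d : forall i, {linear res_mod i -> res_mod i.+1};
  res_aug_graded : is_graded_map res_aug;
  res_d_graded : forall i, is_graded_map (res_d i);
  res_injective : forall i, is_injective (res_mod i);
  res_aug_inj : injective res_aug;
  res_exact0 : [set x | res_d 0%N x = 0] = range res_aug;
  res_exact : forall i, [set x | res_d i.+1 x = 0] = range (res_d i) }.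

(* The functor Gamma_m, of which local cohomology is the right derived functor. *)
Definition torsion (M : gradedMod R) : set M :=
  [set x | exists n, forall a, ideal_set (ideal_pow (irrelevant R) n) a ->
             a *: x = 0].
Arguments torsion M _ : clear implicits.

Definition cocycles (M : gradedMod R) (Q : injectiveResolution M) (i : nat) :
  set (res_mod Q i) := torsion (res_mod Q i) `&` [set x | res_d Q i x = 0].

Definition coboundaries (M : gradedMod R) (Q : injectiveResolution M)
    (i : nat) : set (res_mod Q i) :=
  match i with
  | 0%N => [set 0]
  | i'.+1 => res_d Q i' @` torsion (res_mod Q i')
  end.

(* H^i_m(M)_j <> 0: a cocycle of degree j of Gamma_m of a graded injective
   resolution is not a coboundary.  The cohomology does not depend on the
   resolution, and resolutions exist, so [exists Q] and [forall Q] agree. *)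
Definition lc_nonzero (M : gradedMod R) (i : nat) (j : int) : Prop :=
  exists (Q : injectiveResolution M) (x : res_mod Q i),
    [/\ mdeg j x, cocycles x & ~ coboundaries x].

(* Both are extended integers.  A set of natural numbers attains its infimum;
   a set of integers with a supremum below +oo attains it, so that the supremum
   is the usual maximum whenever the latter exists.  The first argument is the
   value on the empty set, that is, for modules without local cohomology. *)
Definition depth (M : gradedMod R) : \bar int :=
  infimum +oo%E [set (Posz i)%:E | i in [set i | exists j, lc_nonzero M i j]].

Definition reg (M : gradedMod R) : \bar int :=
  supremum -oo%E
    [set (Posz ij.1 + ij.2)%:E | ij in [set ij | lc_nonzero M ij.1 ij.2]].

Definition nonzerodivisor (f : R) (M : gradedMod R) : Prop :=
  forall x : M, f *: x = 0 -> x = 0.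

End LocalCohomology.

(* Main.v *)
Require Import Defs.
From HB Require Import structures.
From mathcomp Require Import all_boot all_order all_algebra.
From mathcomp Require Import boolp classical_sets functions.
From mathcomp Require Import constructive_ereal zify.

(** Write J = (I, f) and d = deg f.  As f is regular modulo every power of I,
    for all a and all m >= 1 the ideal W = I^(a+1) J^(m-1) satisfies
      J^(a+m) = W + f^m J^a   and   f^m x in W implies x in I^(a+1),
    which makes
      0 -> R/I^(a+1)(-md) -> R/J^a(-md) + R/W -> R/J^(a+m) -> 0
    exact, where the maps are projections and multiplications by f^m
    (sum_pow_decomp, long_square).  For m = 1 the ideal W is I^(a+1) itself
    (step_square).  Everything follows from the long exact sequence of local
    cohomology of these Mayer-Vietoris sequences (sq_exact_A, sq_exact_B,
    sq_exact_A').  Below, H^i is the i-th local cohomology.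

    Depth.  Take x <> 0 in H^i(R/J^a).  If f x <> 0 in H^i(R/J^(a+1)), that
    cohomology is nonzero.  If f x = 0, the case m = 1 makes x the image of a
    class of R/I^(a+1); as the projection R/I^(a+1) -> R/J^a passes through
    R/J^(a+1), the image of that class in H^i(R/J^(a+1)) is again nonzero
    (nonzero_class_succ).

    Regularity.  The natural sequence 0 -> R/J^a(-d) -> R/J^(a+1) need not
    induce injections on cohomology, so the claim is proved, by induction on t,
    for all T >= t at once: a nonzero class of R/J^t of total degree c yields
    one of R/J^T of total degree at least c + (T - t) d (nonzero_class_grow).
    For t = a + 1 the case m = 1 turns the given class into a class of R/J^a,
    covered by the induction, or of R/I^(a+1).  The latter is torsion, hence,
    if d > 0, a multiple of it by a power of f is nonzero and killed by f
    (killed_class).  With m = T - a this multiple dies in H^i(R/W), because f^m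
    factors through multiplication by f on R/I^(a+1); so either it survives in
    H^i(R/J^a), and the induction applies again, or it comes from
    H^(i-1)(R/J^T) in degree increased by m d (nonzero_class_base).  If d = 0
    the depth argument already preserves degrees.

    The cohomology is computed by a functorial resolution.  The module coind M
    of finite sums of homogeneous k-linear maps R -> M is injective because k is
    a field, M embeds in it, and iterating gives the cobar resolution, which is an exact functor of M; the comparison of resolutions
    (resolution_lift, homotopy) shows that any other resolution gives the same
    nonvanishing. *)

Set Implicit Arguments.
Unset Strict Implicit.
Unset Printing Implicit Defensive.
Import Order.TTheory GRing.Theory Num.Theory.
Local Open Scope classical_set_scope.
Local Open Scope ring_scope.

(** * Homogeneous components *)

Section Components.
Variables (I : choiceType) (V : zmodType).
Implicit Types (G : I -> set V) (c : I -> V) (v : V).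

Lemma sum_undup_sub (s t : seq I) c : uniq s -> {subset s <= t} -> uniq t ->
  (forall i, i \notin s -> c i = 0) -> \sum_(i <- s) c i = \sum_(i <- t) c i.
Proof.
move=> us st ut cs; rewrite [RHS](bigID (mem s)) /=.
rewrite [X in _ + X]big1 ?addr0; last by move=> i; exact: cs.
rewrite -[RHS]big_filter; apply: perm_big; apply: uniq_perm => //.
  exact: filter_uniq.
by move=> i; rewrite mem_filter /=; case: (boolP (i \in s)) => // /st ->.
Qed.

(** Existence of decompositions need only be checked on generators of the group,
    and their uniqueness only for the decompositions of 0. *)
Lemma grading_intro G :
    (forall i, G i 0 /\ forall u v, G i u -> G i v -> G i (u - v)) ->
    (forall v (S : set V), S 0 -> (forall u v, S u -> S v -> S (u - v)) ->
       (forall i, G i `<=` S) -> S v) ->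
    (forall (s : seq I) c, uniq s -> (forall i, G i (c i)) ->
       \sum_(i <- s) c i = 0 -> forall i, i \in s -> c i = 0) ->
  is_grading G.
Proof.
move=> sG span indep; split=> // v.
have exB u w : (exists c, decomp G c u) -> (exists c, decomp G c w) ->
    exists c, decomp G c (u - w).
  move=> [c /decompP[Gc [s [us cs ->]]]] [c' /decompP[Gc' [s' [us' cs' ->]]]].
  exists (fun i => c i - c' i); apply/decompP.
  split=> [i|]; first exact: (sG i).2.
  exists (undup (s ++ s')); split; first exact: undup_uniq.
    by move=> i; rewrite mem_undup mem_cat negb_or => /andP[/cs -> /cs' ->];
      rewrite subr0.
  rewrite sumrB; congr (_ - _); apply: sum_undup_sub; rewrite ?undup_uniq //.
    by move=> i; rewrite mem_undup mem_cat => ->.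
  by move=> i; rewrite mem_undup mem_cat orbC => ->.
have [c d] : exists c, decomp G c v.
  apply: (span v [set v | exists c, decomp G c v]) => [|u w|i u Gu].
  - exists (fun=> 0); apply/decompP; split=> [i|]; first by case: (sG i).
    by exists [::]; split=> //; rewrite big_nil.
  - exact: exB.
  - exists (fun l => if l == i then u else 0); apply/decompP; split=> [l|].
      by case: eqP => [->|_] //; case: (sG l).
    exists [:: i]; split=> // [l|]; last by rewrite big_seq1 eqxx.
    by rewrite inE => /negbTE->.
exists c; split=> // c' d'.
have [Gc [s [us cs ev]]] := (decompP _ _ _).1 d.
have [Gc' [s' [us' cs' ev']]] := (decompP _ _ _).1 d'.
pose t := undup (s ++ s').
have E : \sum_(i <- t) (c i - c' i) = 0.
  have sub1 : {subset s <= t} by move=> i; rewrite mem_undup mem_cat => ->.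
  have sub2 : {subset s' <= t} by move=> i; rewrite mem_undup mem_cat orbC => ->.
  rewrite sumrB -(sum_undup_sub us sub1 (undup_uniq _) cs).
  by rewrite -(sum_undup_sub us' sub2 (undup_uniq _) cs') -ev -ev' subrr.
apply: funext => i; have [it|] := boolP (i \in t).
  apply/eqP; rewrite -subr_eq0; apply/eqP.
  by apply: (indep _ (fun i => c i - c' i) (undup_uniq _) _ E) => // l; apply: (sG l).2.
by rewrite mem_undup mem_cat negb_or => /andP[/cs -> /cs' ->].
Qed.

Variables (G : I -> set V) (gG : is_grading G).

Definition hpart v : I -> V := projT1 (cid (decomp_ex gG v)).

Lemma hpartP v : decomp G (hpart v) v.
Proof. exact: projT2 (cid (decomp_ex gG v)). Qed.

Lemma hpart_in v i : G i (hpart v i).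
Proof. by case: (hpartP v). Qed.

Lemma hpart_eq c v : decomp G c v -> hpart v = c.
Proof. exact: decomp_uniq (hpartP v). Qed.

Lemma hpart_homog i v : G i v -> hpart v i = v.
Proof. by move=> /(decomp_homog gG)/hpart_eq->; rewrite eqxx. Qed.

Lemma hpartB u v i : hpart (u - v) i = hpart u i - hpart v i.
Proof. by rewrite (hpart_eq (decompB gG (hpartP u) (hpartP v))). Qed.

Lemma hpart0 i : hpart 0 i = 0.
Proof. by rewrite (hpart_eq (decomp0 gG)). Qed.

Lemma hpartD u v i : hpart (u + v) i = hpart u i + hpart v i.
Proof. by rewrite (hpart_eq (decompD gG (hpartP u) (hpartP v))). Qed.

Lemma hpart_ind (S : set V) v : S 0 -> (forall u v, S u -> S v -> S (u + v)) ->
  (forall i, S (hpart v i)) -> S v.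
Proof.
move=> S0 SD Sc; have [_ [s [_ _ ->]]] := (decompP _ _ _).1 (hpartP v).
exact: set_sum.
Qed.

Lemma homog_ind (S : set V) v : S 0 -> (forall u v, S u -> S v -> S (u + v)) ->
  (forall i, G i `<=` S) -> S v.
Proof. by move=> S0 SD GS; apply: hpart_ind => // i; exact/GS/hpart_in. Qed.

Lemma grading_indep (s : seq I) c : uniq s -> (forall i, G i (c i)) ->
  \sum_(i <- s) c i = 0 -> forall i, i \in s -> c i = 0.
Proof.
move=> us Gc E i si; pose c' i := if i \in s then c i else 0.
suff d : decomp G c' 0.
  by have := congr1 (@^~ i) (decomp_uniq gG d (decomp0 gG)); rewrite /c' si.
apply/decompP; split=> [l|]; first by rewrite /c'; case: ifP => // _; exact: grad0 gG l.
exists s; split=> // [l|]; first by rewrite /c' => /negbTE->.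
by rewrite (eq_big_seq c) // => l sl; rewrite /c' sl.
Qed.

End Components.

(** A homomorphism that shifts degrees by the bijection [a] commutes with taking
    components, since it carries decompositions to decompositions. *)
Lemma hpart_map (I I' : choiceType) (V V' : zmodType) (G : I -> set V)
    (G' : I' -> set V') (gG : is_grading G) (gG' : is_grading G')
    (a : I -> I') (b : I' -> I) (h : V -> V') :
  cancel a b -> cancel b a -> {morph h : x y / x + y} ->
  (forall i x, G i x -> G' (a i) (h x)) ->
  forall x i, hpart gG' (h x) (a i) = h (hpart gG x i).
Proof.
move=> ab ba hD hG x i.
have h0 : h 0 = 0 by apply: (addrI (h 0)); rewrite -hD !addr0.
have [Gc [s [us cs ex]]] := (decompP _ _ _).1 (hpartP gG x).
rewrite (@hpart_eq _ _ _ gG' (fun l => h (hpart gG x (b l)))) ?ab //.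
apply/decompP; split=> [l|]; first by rewrite -[X in G' X _](ba l); apply/hG/Gc.
exists (map a s); split.
- by rewrite map_inj_uniq //; exact: can_inj ab.
- move=> l nl; rewrite cs ?h0 //; apply: contra nl => bl.
  by apply/mapP; exists (b l); rewrite ?ba.
- rewrite big_map {1}ex; under [RHS]eq_bigr do rewrite ab.
  exact: (big_morph h hD h0).
Qed.

(** * Linear and graded maps *)

Section KLinear.
Context {k : fieldType} {R : posGradedAlg k}.

(** The scalars of k act on an R-module through their images in R, which keeps a
    single module structure in play. *)
Definition klinear (X Y : lmodType R) (g : X -> Y) : Prop :=
  forall (c : k) x y, g (c%:A *: x + y) = c%:A *: g x + g y.

Lemma klinD (X Y : lmodType R) (g : X -> Y) : klinear g -> {morph g : x y / x + y}.
Proof. by move=> gL x y; have := gL 1 x y; rewrite !scale1r. Qed.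

Lemma klin0 (X Y : lmodType R) (g : X -> Y) : klinear g -> g 0 = 0.
Proof. by move=> gL; apply: (addrI (g 0)); rewrite -klinD // !addr0. Qed.

Lemma klinB (X Y : lmodType R) (g : X -> Y) : klinear g -> {morph g : x y / x - y}.
Proof.
move=> gL x y; have := gL (- 1) y x.
by rewrite !scaleN1r addrC => ->; rewrite addrC.
Qed.

Lemma linear_klinear (X Y : lmodType R) (g : {linear X -> Y}) : klinear g.
Proof. by move=> c x y; rewrite linearP. Qed.

End KLinear.

Section GradedMaps.
Context {k : fieldType} {R : posGradedAlg k}.
Implicit Types (M N X Y : gradedMod R) (e j : int).

Definition graded_of (X Y : gradedMod R) e (g : X -> Y) : Prop :=
  forall j x, mdeg j x -> mdeg (j + e) (g x).

Record gmap (X Y : gradedMod R) e := Gmap {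
  gfun :> {linear X -> Y};
  gmap_deg : graded_of e gfun }.

Definition mpart (M : gradedMod R) (x : M) (j : int) : M :=
  hpart (mdeg_grading M) x j.

Lemma mpart_in M (x : M) j : mdeg j (mpart x j).
Proof. exact: hpart_in. Qed.

Lemma mpart_map X Y e (g : X -> Y) : {morph g : x y / x + y} -> graded_of e g ->
  forall x j, mpart (g x) (j + e) = g (mpart x j).
Proof.
move=> gD gE x j.
exact: (hpart_map _ _ (a := fun j => j + e) (b := fun j => j - e) (addrK e) (subrK e)).
Qed.

Lemma mpart_gmap X Y e (g : gmap X Y e) x j : mpart (g x) (j + e) = g (mpart x j).
Proof. by apply: mpart_map; [exact: linearD|exact: gmap_deg]. Qed.

Lemma mdeg0 M j : mdeg j (0 : M). Proof. exact: grad0 (mdeg_grading M) j. Qed.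
Lemma mdegB M j (x y : M) : mdeg j x -> mdeg j y -> mdeg j (x - y).
Proof. exact: gradB (mdeg_grading M) j x y. Qed.
Lemma mpart_homog M j (x : M) : mdeg j x -> mpart x j = x.
Proof. exact: hpart_homog. Qed.

Lemma mpart_other M j l (x : M) : mdeg j x -> l != j -> mpart x l = 0.
Proof.
by move=> xj lj; rewrite /mpart (hpart_eq _ (decomp_homog (mdeg_grading M) xj)) (negbTE lj).
Qed.

Lemma deg_one : deg R 0 1.
Proof. by rewrite deg_0; exists 1 => //; rewrite scale1r. Qed.

Lemma mdeg_k M j (c : k) (x : M) : mdeg j x -> mdeg j (c%:A *: x).
Proof.
move=> xj; rewrite -[j]add0r; apply: mdegZ => //.
by rewrite deg_0; exists c.
Qed.

End GradedMaps.

(** * Coinduced modules *)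

Section Coinduced.
Context {k : fieldType} {R : posGradedAlg k}.
Variable M : gradedMod R.
Implicit Types (j : int) (phi : R -> M).

(** The degree j part of the graded module of k-linear maps from R to M. *)
Definition coind_hom j : set (R -> M) :=
  [set phi | klinear (phi : R^o -> M) /\
     forall i r, deg R i r -> mdeg (i%:Z + j) (phi r)].

(** Finite sums of homogeneous k-linear maps: an arbitrary k-linear map may have
    infinitely many homogeneous components, and is then left out. *)
Definition coind_pred : {pred R -> M} :=
  fun phi => `[< smallest (fun S : set (R -> M) =>
     S 0 /\ forall u v, S u -> S v -> S (u - v)) (\bigcup_j coind_hom j) phi >].

Lemma coind_pred_closed : zmod_closed coind_pred.
Proof.
split=> [|u v]; rewrite /in_mem /=; first by apply/asboolP => S [[]].
move=> /asboolP hu /asboolP hv; apply/asboolP => S hS.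
by case: (hS) => -[_ SB] _; apply: SB; [exact: hu|exact: hv].
Qed.
HB.instance Definition _ :=
  GRing.isZmodClosed.Build (R -> M) coind_pred coind_pred_closed.

Record coind_sort := Coind {
  coind_fun :> R -> M;
  coind_funP : coind_fun \in coind_pred }.
HB.instance Definition _ := [isSub for coind_fun].
HB.instance Definition _ := [Choice of coind_sort by <:].
HB.instance Definition _ := [SubChoice_isSubZmodule of coind_sort by <:].
Implicit Types x y : coind_sort.

Lemma coindP x y : (forall r, x r = y r) -> x = y.
Proof. by move=> E; apply/val_inj/funext. Qed.

Lemma coindDE x y r : (x + y) r = x r + y r.
Proof. by []. Qed.
Lemma coindBE x y r : (x - y) r = x r - y r.
Proof. by []. Qed.
Lemma coind_homB j phi psi :
  coind_hom j phi -> coind_hom j psi -> coind_hom j (phi - psi).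
Proof.
move=> [pL pj] [qL qj]; split=> [c u v|i r ri]; last first.
  by apply: mdegB; [exact: pj|exact: qj].
have E r : (phi - psi) r = phi r - psi r by [].
by rewrite !E (pL c u v) (qL c u v) scalerBr opprD addrACA.
Qed.

Lemma coind_hom0 j : coind_hom j 0.
Proof.
have E r : (0 : R -> M) r = 0 by [].
by split=> [c u v|i r _]; rewrite !E ?scaler0 ?addr0 //; exact: mdeg0.
Qed.

Lemma coind_hom_in j phi : coind_hom j phi -> phi \in coind_pred.
Proof. by move=> h; apply/asboolP => S [_]; apply; exists j. Qed.

Lemma coind_sort_ind (S : set coind_sort) x : S 0 ->
  (forall u v, S u -> S v -> S (u - v)) ->
  (forall j (u : coind_sort), coind_hom j u -> S u) -> S x.
Proof.
move=> S0 SB Sh; have /asboolP := coind_funP x.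
move=> /(_ [set phi | exists2 u, S u & coind_fun u = phi])[].
- split; first split; first by exists 0.
  + by move=> _ _ [u Su <-] [v Sv <-]; exists (u - v) => //; exact: SB.
  + move=> phi [j _ h]; exists (Coind (coind_hom_in h)) => //.
    exact: (Sh j (Coind (coind_hom_in h)) h).
- by move=> u Su /val_inj <-.
Qed.

Lemma coind_klinear x : klinear (x : R^o -> M).
Proof.
apply: (coind_sort_ind (S := fun u => klinear (u : R^o -> M))).
- by case: (coind_hom0 0).
- move=> u v uL vL c r s.
  by rewrite !coindBE (uL c r s) (vL c r s) scalerBr opprD addrACA.
- by move=> j u [].
Qed.

(** An element of R acts by translating the argument.  Membership is additive in
    both variables, so it suffices to translate a homogeneous map by a
    homogeneous element. *)
Lemma coind_scale_subproof (a : R) x : (fun r => x (a * r)) \in coind_pred.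
Proof.
pose S (b : R) := is_true ((fun r => x (b * r)) \in coind_pred).
apply: (homog_ind (deg_grading R) (S := S)); rewrite /S {S}.
- rewrite (_ : (fun _ => _) = 0) ?rpred0 //; apply: funext => r.
  by rewrite mul0r (klin0 (coind_klinear x)).
- move=> b c hb hc; rewrite (_ : (fun _ => _) = (fun r => x (b * r)) + (fun r => x (c * r))) ?rpredD //.
  by apply: funext => r; rewrite mulrDl (klinD (coind_klinear x)).
move=> p b bp; apply: (coind_sort_ind (S := fun x => (fun r => x (b * r)) \in coind_pred)).
- by rewrite (_ : (fun _ => _) = 0) ?rpred0 //; apply: funext.
- by move=> u v hu hv; rewrite (_ : (fun _ => _) = (fun r => u (b * r)) - (fun r => v (b * r))) ?rpredB.
move=> j u [uL uj]; apply: (@coind_hom_in (p%:Z + j)); split=> [c r s|i r ri].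
  by rewrite mulrDr mulrCA; exact: uL.
rewrite addrA -PoszD; apply: uj; rewrite addnC; exact: degM.
Qed.

Definition coind_scale (a : R) x : coind_sort := Coind (coind_scale_subproof a x).

Lemma coind_scaleA a b x : coind_scale a (coind_scale b x) = coind_scale (a * b) x.
Proof. by apply: coindP => r /=; rewrite mulrA (mulrC b). Qed.
Lemma coind_scale1 : left_id 1 coind_scale.
Proof. by move=> x; apply: coindP => r /=; rewrite mul1r. Qed.
Lemma coind_scaleDr : right_distributive coind_scale +%R.
Proof. by move=> a x y; apply: coindP. Qed.
Lemma coind_scaleDl x : {morph coind_scale^~ x : a b / a + b}.
Proof.
move=> a b; apply: coindP => r /=.
by rewrite -[RHS]/(x (a * r) + x (b * r)) mulrDl (klinD (coind_klinear x)).
Qed.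
HB.instance Definition _ := GRing.Zmodule_isLmodule.Build R coind_sort
  coind_scaleA coind_scale1 coind_scaleDr coind_scaleDl.

Lemma coindZE (a : R) x r : (a *: x) r = x (a * r).
Proof. by []. Qed.

Definition coind_deg j : set coind_sort := [set x | coind_hom j x].

(** A vanishing sum of homogeneous maps of different degrees vanishes termwise at
    each homogeneous argument, by independence of the degrees in M, and
    homogeneous arguments generate R. *)
Lemma coind_grading : is_grading coind_deg.
Proof.
apply: grading_intro => [j|x S S0 SB GS|s c us cG E j js].
- by split=> [|u v]; [exact: coind_hom0|exact: coind_homB].
- by apply: (coind_sort_ind (S := S)) => // j u; exact: GS.
apply: coindP => r; apply: (homog_ind (deg_grading R) (S := fun r => c j r = 0)).
- exact: klin0 (coind_klinear (c j)).
- by move=> u v cu cv; rewrite (klinD (coind_klinear (c j))) cu cv addr0.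
move=> i {}r ri /=.
have Er : \sum_(l <- map (fun l => i%:Z + l) s) c (l - i%:Z) r = 0.
  rewrite big_map; under eq_bigr do rewrite addrC addKr.
  have sumE : forall t : seq int, (\sum_(l <- t) c l) r = \sum_(l <- t) c l r.
    by elim=> [|a t IH]; rewrite ?big_nil // !big_cons -IH.
  by rewrite -sumE E.
have := grading_indep (mdeg_grading M) (c := fun l => c (l - i%:Z) r) _ _ Er
  (i := i%:Z + j).
rewrite (_ : i%:Z + j - i%:Z = j); last by rewrite addrAC subrr add0r.
apply.
- by rewrite map_inj_uniq //; exact: addrI.
- move=> l; have [_ h] := cG (l - i%:Z).
  by rewrite -[l in mdeg l](subrK i%:Z) addrC; apply: h.
- by apply: map_f.
Qed.

Lemma coind_degZ (i : nat) (j : int) (a : R) x :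
  deg R i a -> coind_deg j x -> coind_deg (i%:Z + j) (a *: x).
Proof.
move=> ai [xL xj]; split=> [c r s|l r rl].
  by rewrite !coindZE mulrDr mulrCA; exact: xL.
rewrite coindZE addrA -PoszD; apply: xj; rewrite addnC; exact: degM.
Qed.

Definition coind : gradedMod R := GradedMod coind_grading coind_degZ.

Lemma eval1_klinear : klinear (fun phi : coind => phi 1).
Proof.
move=> c x y; have xL := coind_klinear x.
rewrite coindDE coindZE; congr (_ + _).
by have := xL c 1 0; rewrite addr0 (klin0 xL) addr0.
Qed.

Lemma eval1_deg j (phi : coind) : mdeg j phi -> mdeg j (phi 1).
Proof. by move=> [_ h]; rewrite -[j]add0r; apply/h/deg_one. Qed.

End Coinduced.

Section Coext.
Context {k : fieldType} {R : posGradedAlg k}.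
Variables (X N : gradedMod R) (e : int) (h : X -> N).
Hypotheses (hL : klinear h) (hE : graded_of e h).

Lemma coext_hom j (x : X) : mdeg j x -> coind_hom (j + e) (fun r => h (r *: x)).
Proof.
move=> xj; split=> [c r s|i r ri]; last first.
  by rewrite addrA; apply/hE/mdegZ.
by rewrite -[_ + s]/(c%:A * r + s) scalerDl -scalerA hL.
Qed.

Lemma coext_subproof (x : X) : (fun r => h (r *: x)) \in coind_pred (M := N).
Proof.
apply: (homog_ind (mdeg_grading X) (S := fun x => (fun r => h (r *: x)) \in coind_pred (M := N))).
- rewrite (_ : (fun _ => _) = 0) ?rpred0 //; apply: funext => r.
  by rewrite scaler0 klin0.
- move=> u v hu hv; rewrite (_ : (fun _ => _) = (fun r => h (r *: u)) + (fun r => h (r *: v))) ?rpredD //.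
  by apply: funext => r; rewrite scalerDr klinD.
- by move=> j u /coext_hom/coind_hom_in.
Qed.

Definition coext_fun (x : X) : coind N := Coind (coext_subproof x).

Lemma coext_linear : linear coext_fun.
Proof.
move=> a u v; apply: coindP => r.
by rewrite coindDE coindZE /= scalerDr klinD // scalerA mulrC.
Qed.
HB.instance Definition _ := GRing.isLinear.Build R X (coind N) *:%R coext_fun coext_linear.

Lemma coext_deg : graded_of e coext_fun.
Proof. by move=> j x /coext_hom. Qed.

(** One direction of the adjunction: k-linear maps X -> N correspond to R-linear
    maps from X to the module coinduced by N, the inverse being evaluation at 1. *)
Definition coext : gmap X (coind N) e := Gmap coext_deg.

Lemma coextE x r : coext x r = h (r *: x).
Proof. by []. Qed.
End Coext.

(** * Extension of maps and injectivity *)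

Section Extension.
Context {k : fieldType} {R : posGradedAlg k}.
Implicit Types (X Y V E M : gradedMod R) (e j : int).

Lemma mpartZ Y (c : k) (x : Y) j : mpart (c%:A *: x) j = c%:A *: mpart x j.
Proof.
rewrite -{1}[j]addr0 (@mpart_map _ _ Y Y 0 (fun x => c%:A *: x)) //.
  by move=> y z; rewrite scalerDr.
by move=> l y yl; rewrite addr0; exact: mdeg_k.
Qed.

Lemma mpartD Y (x y : Y) j : mpart (x + y) j = mpart x j + mpart y j.
Proof. exact: hpartD. Qed.

Lemma scale_algVK (c : k) (M : lmodType R) (x : M) : c != 0 ->
  (c^-1)%:A *: (c%:A *: x) = x.
Proof.
by move=> c0; rewrite scalerA -scalerAl mul1r scalerA mulVf // !scale1r.
Qed.

Definition homogeneous Y (N : set Y) : Prop := forall x j, N x -> N (mpart x j).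

Definition ksubspace Y (N : set Y) : Prop :=
  N 0 /\ forall (c : k) x y, N x -> N y -> N (c%:A *: x + y).

Lemma ksubspaceZ Y (N : set Y) (c : k) x : ksubspace N -> N x -> N (c%:A *: x).
Proof. by case=> N0 NL Nx; rewrite -[_ *: _]addr0; exact: NL. Qed.

Lemma ksubspaceD Y (N : set Y) x y : ksubspace N -> N x -> N y -> N (x + y).
Proof. by case=> N0 NL Nx Ny; have := NL 1 x y Nx Ny; rewrite !scale1r. Qed.

Lemma ksubspaceB Y (N : set Y) x y : ksubspace N -> N x -> N y -> N (x - y).
Proof.
by case=> N0 NL Nx Ny; have := NL (- 1) y x Ny Nx; rewrite scaleN1r scaleN1r addrC.
Qed.

(** Zorn's lemma for homogeneous subspaces meeting N trivially.  Working with
    homogeneous subspaces from the start makes the resulting projection graded. *)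
Lemma homogeneous_complement Y (N : set Y) : ksubspace N -> homogeneous N ->
  exists A : set Y, [/\ ksubspace A, homogeneous A,
    forall x, A x -> N x -> x = 0
    & forall y, exists2 s, A s & N (y - s)].
Proof.
move=> kN hN.
pose P (A : set Y) := [/\ forall (c : k) x y, A x -> A y -> A (c%:A *: x + y),
  homogeneous A & forall x, A x -> N x -> x = 0].
have [|A [[AL hA AN] Amax]] := @Zorn_bigcup Y P.
  move=> F FP Ftot; split=> [c x y [A FA Ax] [B FB By]|x j [A FA Ax]|x [A FA Ax]].
  - have [AB|BA] := Ftot _ _ FA FB.
      by exists B => //; case: (FP _ FB) => + _ _; apply=> //; exact: AB.
    by exists A => //; case: (FP _ FA) => + _ _; apply=> //; exact: BA.
  - by exists A => //; case: (FP _ FA) => _ + _; apply.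
  - by case: (FP _ FA) => _ _; apply.
(* The empty set is allowed in P, so that unions of empty chains are. *)
have A0 : A 0.
  apply: contrapT => nA0.
  have A_empty x : ~ A x.
    by move=> Ax; apply: nA0; rewrite -(addNr x) -scaleN1r -(scaleN1r (1 : R)); exact: AL.
  apply: (Amax [set 0]); first by split=> [x /A_empty//|/(_ 0 erefl)].
  split=> [c x y -> ->|x j ->|//]; first by rewrite scaler0 addr0.
  exact: hpart0.
have kA : ksubspace A by split.
exists A; split=> // y.
apply: (homog_ind (mdeg_grading Y) (S := fun y => exists2 s, A s & N (y - s))).
- by exists 0; rewrite ?subr0 //; case: kN.
- move=> u v [s As Ns] [t At Nt]; exists (s + t); first exact: ksubspaceD.
  by rewrite opprD addrACA; exact: ksubspaceD.
move=> j {}y yj /=; apply: contrapT => ny.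
(* A homogeneous y outside A + N could be added to A. *)
pose B := [set x | exists2 s, A s & exists c : k, x = s + c%:A *: y].
apply: (Amax B).
  split=> [x Ax|sBA]; first by exists x => //; exists 0; rewrite scale0r scale0r addr0.
  apply: ny; exists y; last by rewrite subrr; case: kN.
  by apply: sBA; exists 0 => //; exists 1; rewrite !scale1r add0r.
split.
- move=> c _ _ [s As [a ->]] [t At [b ->]].
  exists (c%:A *: s + t); first exact: AL.
  exists (c * a + b); rewrite scalerDr addrACA; congr (_ + _).
  by rewrite scalerA -scalerAl mul1r scalerA -scalerDl -scalerDl.
- move=> _ l [s As [a ->]].
  exists (mpart s l); first exact: hA.
  have [->|lj] := eqVneq l j.
    by exists a; rewrite mpartD mpartZ [mpart y j]mpart_homog.
  by exists 0; rewrite mpartD mpartZ [mpart y l](mpart_other yj) // scale0r scale0r scaler0.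
- move=> _ [s As [c ->]] Nx.
  have [c0|c0] := eqVneq c 0.
    by move: Nx; rewrite c0 scale0r scale0r addr0 => Ns; exact: AN.
  case: ny; exists ((- c^-1)%:A *: s); first exact: ksubspaceZ.
  have -> : y - (- c^-1)%:A *: s = (c^-1)%:A *: (s + c%:A *: y).
    by rewrite scalerDr scale_algVK // addrC scaleNr scaleNr opprK.
  exact: ksubspaceZ.
Qed.

Lemma graded_projection Y (N : set Y) : ksubspace N -> homogeneous N ->
  exists p : Y -> Y, [/\ klinear p, graded_of 0 p,
    forall x, N x -> p x = 0 & forall x, N (x - p x)].
Proof.
move=> kN hN; have [A [kA hA AN YAN]] := homogeneous_complement kN hN.
have pP y : {s | A s & N (y - s)} by apply: cid2; exact: YAN.
pose p y := s2val (pP y).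
have Ap y : A (p y) by exact: s2valP (pP y).
have Np y : N (y - p y) by exact: s2valP' (pP y).
have pE y s : A s -> N (y - s) -> p y = s.
  move=> As Ns; apply/eqP; rewrite -subr_eq0; apply/eqP; apply: AN.
    exact: ksubspaceB.
  rewrite (_ : p y - s = (y - s) - (y - p y)); first exact: ksubspaceB.
  by rewrite opprB [RHS]addrC addrA subrK.
exists p; split=> //.
- move=> c x y; apply: pE; first by case: kA => _; apply.
  rewrite opprD addrACA -scalerBr; case: kN => _; exact.
- move=> j y yj; rewrite addr0.
  have Ey : mpart y j = y := mpart_homog yj.
  rewrite (pE y (mpart (p y) j)); [exact: mpart_in|exact: hA|].
  by rewrite -{1}Ey -hpartB; exact: hN.
- by move=> x Nx; apply: pE; rewrite ?subr0 //; case: kA.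
Qed.

(** Project the target of u onto its image along a graded complement, lift through
    u and apply g; the choice of the lift is immaterial because g vanishes on the
    kernel of u. *)
Lemma klinear_ext X Y V e (u : gmap X Y 0) (g : X -> V) :
    klinear g -> graded_of e g -> (forall x, u x = 0 -> g x = 0) ->
  exists h : Y -> V, [/\ klinear h, graded_of e h & forall x, h (u x) = g x].
Proof.
move=> gL ge ug; pose N := range u.
have kN : ksubspace N.
  split; first by exists 0; rewrite ?linear0.
  by move=> c _ _ [x _ <-] [y _ <-]; exists (c%:A *: x + y) => //; rewrite linearP.
have hN : homogeneous N.
  move=> _ j [x _ <-]; exists (mpart x j) => //.
  by rewrite -mpart_gmap addr0.
have [p [pL p0 pN Np]] := graded_projection kN hN.
have hP y : {x | u x = y - p y} by apply: cid; have [x _ ?] := Np y; exists x.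
have gE x x' : u x = u x' -> g x = g x'.
  move=> E; apply/eqP; rewrite -subr_eq0 -klinB //; apply/eqP/ug.
  by rewrite linearB E subrr.
exists (fun y => g (sval (hP y))); split.
- move=> c x y; rewrite -gL; apply: gE; rewrite linearP !(svalP (hP _)) pL.
  by rewrite opprD addrACA scalerBr.
- move=> j y yj; rewrite (gE _ (mpart (sval (hP y)) j)); first exact/ge/mpart_in.
  have E := mpart_gmap u (sval (hP y)) j.
  rewrite -E (svalP (hP y)) mpart_homog // addr0; apply: mdegB => //.
  by rewrite -[j]addr0; exact: p0.
- move=> x; apply: gE; rewrite (svalP (hP _)) pN ?subr0 //; by exists x.
Qed.

Lemma gmap_deg0 X Y (u : gmap X Y 0) : is_graded_map u.
Proof. by move=> j x xj; rewrite -[j]addr0; exact: gmap_deg. Qed.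

(** By adjunction, extending an R-linear map to a coinduced module amounts to
    extending a k-linear map. *)
Lemma coind_ext X Y V e (u : gmap X Y 0) (g : gmap X (coind V) e) :
    (forall x, u x = 0 -> g x = 0) ->
  exists h : gmap Y (coind V) e, forall x, h (u x) = g x.
Proof.
move=> ug.
have gL : klinear (fun x => g x 1 : V).
  by move=> c x y; rewrite linearP; exact: (eval1_klinear (M := V)).
have gE : graded_of e (fun x => g x 1 : V).
  by move=> j x xj; exact/eval1_deg/gmap_deg.
have [|h [hL he hu]] := klinear_ext (u := u) gL gE.
  by move=> x /ug ->.
exists (coext hL he) => x; apply: coindP => r.
by rewrite coextE -linearZ hu linearZ coindZE mulr1.
Qed.

Lemma coind_injective V : is_injective (coind V).
Proof.
move=> M N u f ug uI fg.
have ud : graded_of 0 u by move=> j x; rewrite addr0; exact: ug.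
have fd : graded_of 0 f by move=> j x; rewrite addr0; exact: fg.
have [x ux|h hu] := @coind_ext M N V 0 (Gmap ud) (Gmap fd).
  by rewrite (uI x 0) ?linear0.
by exists h => //; exact: gmap_deg0.
Qed.

Lemma id_graded M : graded_of 0 (@id M).
Proof. by move=> j x; rewrite addr0. Qed.

Lemma id_klinear M : klinear (@id M).
Proof. by []. Qed.

Definition coind_unit M : gmap M (coind M) 0 :=
  coext (@id_klinear M) (@id_graded M).

Lemma coind_unit_inj M : injective (coind_unit M).
Proof.
by move=> x y /(congr1 (fun phi : coind M => phi 1)); rewrite !coextE !scale1r.
Qed.

(** An injective module is a retract of its coinduced module, which reduces the
    claim to [coind_ext].  This gives at once the extension along maps that are not
    injective and the extension of maps of nonzero degree, neither of which
    is part of the definition of injectivity. *)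
Lemma injective_ext X Y E e (u : gmap X Y 0) (g : gmap X E e) :
    is_injective E -> (forall x, u x = 0 -> g x = 0) ->
  exists h : gmap Y E e, forall x, h (u x) = g x.
Proof.
move=> injE ug.
have [|p pg pE] := injE _ _ (coind_unit E) (@idfun E : {linear E -> E})
  (@gmap_deg0 _ _ _) (@coind_unit_inj E).
  by [].
have gd : graded_of e (coind_unit E \o g).
  by move=> j x xj; apply: gmap_deg0; exact: gmap_deg.
have [x /ug /= ->|h hu] := @coind_ext X Y E e u (Gmap gd).
  by rewrite linear0.
have hd : graded_of e (p \o h) by move=> j x xj; apply: pg; exact: gmap_deg.
exists (Gmap hd) => x /=.
by rewrite hu; exact: pE.
Qed.
End Extension.

(** * The cobar resolution *)

Section Cobar.
Context {k : fieldType} {R : posGradedAlg k}.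
Implicit Types (M X : gradedMod R).

Lemma cobar_step_klinear X (D : gmap X (coind X) 0) :
  klinear (fun phi : coind X => phi - D (phi 1)).
Proof.
move=> c x y; cbv beta.
by rewrite [X in D X](eval1_klinear c x y) linearP scalerBr opprD addrACA.
Qed.

Lemma cobar_step_graded X (D : gmap X (coind X) 0) :
  graded_of 0 (fun phi : coind X => phi - D (phi 1)).
Proof.
move=> j x xj; rewrite addr0; apply: mdegB => //.
exact/gmap_deg0/eval1_deg.
Qed.

(** The differential after D is the inclusion of the coinduced module into its own
    coinduced module minus the map induced by D; see [cobar_dSE]. *)
Definition cobar_step X (D : gmap X (coind X) 0) : gmap (coind X) (coind (coind X)) 0 :=
  coext (cobar_step_klinear D) (cobar_step_graded D).

(** The term of index n + 1 is the n-th injective of the resolution, and M itself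
    is the term of index 0, so that the augmentation is one of the
    differentials. *)
Fixpoint cobar M (n : nat) : gradedMod R :=
  if n is n'.+1 then coind (cobar M n') else M.

Fixpoint cobar_d M (n : nat) : gmap (cobar M n) (cobar M n.+1) 0 :=
  match n with
  | 0 => coind_unit M
  | n'.+1 => cobar_step (cobar_d M n')
  end.

Lemma cobar_d0E M (x : M) r : cobar_d M 0 x r = r *: x.
Proof. by []. Qed.

Lemma cobar_dSE M n (x : cobar M n.+1) r :
  cobar_d M n.+1 x r = r *: x - cobar_d M n (x r).
Proof. by have -> : x r = (r *: x : coind _) 1 by rewrite coindZE mulr1. Qed.

Lemma cobar_dd M n (x : cobar M n) : cobar_d M n.+1 (cobar_d M n x) = 0.
Proof.
elim: n x => [|n IH] x; apply: coindP => r; rewrite cobar_dSE.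
  by rewrite cobar_d0E linearZ subrr.
by rewrite cobar_dSE linearB IH subr0 linearZ subrr.
Qed.

(** Evaluating the equation d x = 0 at 1 exhibits x as a boundary: evaluation at 1
    is a k-linear contracting homotopy. *)
Lemma cobar_kernel M n (x : cobar M n.+1) :
  cobar_d M n.+1 x = 0 -> x = cobar_d M n (x 1).
Proof.
move=> /(congr1 (fun phi : cobar M n.+2 => phi 1)); rewrite cobar_dSE scale1r.
by move=> E; apply/eqP; rewrite -subr_eq0; apply/eqP.
Qed.

Lemma cobar_exact M n :
  [set x | cobar_d M n.+1 x = 0] = range (cobar_d M n).
Proof.
apply/seteqP; split=> [x /cobar_kernel E|_ [x _ <-]]; last exact: cobar_dd.
by exists (x 1).
Qed.

Definition cobar_resolution M : injectiveResolution M :=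
  @InjectiveResolution k R M (fun i => cobar M i.+1) (cobar_d M 0)
    (fun i => cobar_d M i.+1) (@gmap_deg0 _ _ _ _ _) (fun i => @gmap_deg0 _ _ _ _ _)
    (fun i => @coind_injective k R (cobar M i)) (@coind_unit_inj k R M)
    (cobar_exact M 0) (fun i => cobar_exact M i.+1).

End Cobar.

(** * Products and powers of ideals *)

Section IdealPowers.
Context {k : fieldType} {R : posGradedAlg k}.
Implicit Types I J K : gradedIdeal R.

Lemma ideal_mul_sub I J (S : set R) : is_ideal S ->
  (forall a b, ideal_set I a -> ideal_set J b -> S (a * b)) ->
  ideal_set (ideal_mul I J) `<=` S.
Proof.
move=> iS h; change (mul_set (ideal_set I) (ideal_set J) `<=` S).
by move=> x; apply; split=> // _ [a Ia [b Jb ->]]; exact: h.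
Qed.

Lemma ideal_mul_in I J a b : ideal_set I a -> ideal_set J b ->
  ideal_set (ideal_mul I J) (a * b).
Proof.
move=> Ia Jb; change (mul_set (ideal_set I) (ideal_set J) (a * b)).
by move=> S [_]; apply; exists a => //; exists b.
Qed.

Lemma ideal_mul_subr I J : ideal_set (ideal_mul I J) `<=` ideal_set J.
Proof.
apply: ideal_mul_sub => [|a b _ Jb]; first exact: ideal_ideal.
exact: (idealM (ideal_ideal J)).
Qed.

Lemma ideal_mul_subl I J : ideal_set (ideal_mul I J) `<=` ideal_set I.
Proof.
apply: ideal_mul_sub => [|a b Ia _]; first exact: ideal_ideal.
by rewrite mulrC; exact: (idealM (ideal_ideal I)).
Qed.

Lemma ideal_pow_le I m n : (m <= n)%N ->
  ideal_set (ideal_pow I n) `<=` ideal_set (ideal_pow I m).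
Proof.
move=> /subnKC <-; elim: (n - m)%N => [|l IH]; first by rewrite addn0.
by rewrite addnS => x /ideal_mul_subr /IH.
Qed.

End IdealPowers.

(** * Independence of the resolution *)

Section Comparison.
Context {k : fieldType} {R : posGradedAlg k}.
Implicit Types (M N X Y Z : gradedMod R) (e j : int).

Lemma torsion_map X Y (u : {linear X -> Y}) x :
  torsion (M := X) x -> torsion (M := Y) (u x).
Proof. by move=> [n h]; exists n => a /h ax; rewrite -linearZ ax linear0. Qed.

Lemma torsion0 X : torsion (M := X) 0.
Proof. by exists 0%N => a _; rewrite scaler0. Qed.

Lemma torsionB X (x y : X) : torsion x -> torsion y -> torsion (x - y).
Proof.
move=> [m hx] [n hy]; exists (m + n)%N => a Ja.
by rewrite scalerBr hx ?hy ?subrr //; apply: ideal_pow_le Ja;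
  rewrite ?leq_addr ?leq_addl.
Qed.

Lemma coboundariesB M (Q : injectiveResolution M) i (x y : res_mod Q i) :
  coboundaries x -> coboundaries y -> coboundaries (x - y).
Proof.
case: i x y => [|i] x y; first by move=> -> ->; rewrite /= subr0.
move=> [a ta <-] [b tb <-]; exists (a - b); last by rewrite linearB.
exact: torsionB.
Qed.

Lemma graded_of0 X Y (u : X -> Y) : is_graded_map u -> graded_of 0 u.
Proof. by move=> ug j x /ug; rewrite addr0. Qed.

Lemma graded_comp X Y Z e (u : X -> Y) (v : Y -> Z) :
  graded_of e u -> graded_of 0 v -> graded_of e (v \o u).
Proof. by move=> ue v0 j x /ue/v0; rewrite addr0. Qed.

Definition res_gd M (Q : injectiveResolution M) i :
  gmap (res_mod Q i) (res_mod Q i.+1) 0 := Gmap (graded_of0 (@res_d_graded k R M Q i)).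

Definition res_gaug M (Q : injectiveResolution M) :
  gmap M (res_mod Q 0) 0 := Gmap (graded_of0 (@res_aug_graded k R M Q)).

Lemma res_dd M (Q : injectiveResolution M) i (x : res_mod Q i) :
  res_d Q i.+1 (res_d Q i x) = 0.
Proof.
have : range (res_d Q i) (res_d Q i x) by exists x.
by rewrite -res_exact.
Qed.

(** Each stage extends the previous one along the differential of Q.  The invariant
    carried by the recursion is that cocycles go to cocycles. *)
Lemma resolution_lift M (Q P : injectiveResolution M) :
  exists phi : forall i, gmap (res_mod Q i) (res_mod P i) 0,
    forall i x, phi i.+1 (res_d Q i x) = res_d P i (phi i x) /\
    forall x, phi 0%N (res_aug Q x) = res_aug P x.
Proof.
pose S i := {u : gmap (res_mod Q i) (res_mod P i) 0 |
  forall x, res_d Q i x = 0 -> res_d P i (u x) = 0}.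
have base : exists s : S 0%N, forall x, sval s (res_aug Q x) = res_aug P x.
  have [|x x0|h hE] := @injective_ext _ _ _ _ _ _ (res_gaug Q) (res_gaug P).
  - exact: res_injective.
  - have -> : x = 0 by apply: (@res_aug_inj k R M Q); rewrite linear0.
    exact: linear0.
  have hd x : res_d Q 0 x = 0 -> res_d P 0 (h x) = 0.
    move=> x0; have : range (res_aug Q) x by rewrite -res_exact0.
    move=> [m _ <-]; have := hE m => /= ->.
    suff : range (res_aug P) (res_aug P m) by rewrite -res_exact0.
    by exists m.
  by exists (exist _ h hd).
have step i (s : S i) : {s' : S i.+1 |
    forall x, sval s' (res_d Q i x) = res_d P i (sval s x)}.
  apply: cid; case: s => u hu /=.
  have gd : graded_of 0 (res_d P i \o u).
    by apply: graded_comp; [exact: gmap_deg|exact/graded_of0/res_d_graded].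
  have [|x /hu //|h hE] := @injective_ext _ _ _ _ _ _ (res_gd Q i) (Gmap gd).
    exact: res_injective.
  have hd x : res_d Q i.+1 x = 0 -> res_d P i.+1 (h x) = 0.
    move=> x0; have : range (res_d Q i) x by rewrite -res_exact.
    by move=> [m _ <-]; have := hE m => /= ->; rewrite res_dd.
  by exists (exist _ h hd).
have [s0 s0E] := base.
pose s := fix s i : S i := if i is i'.+1 then sval (step i' (s i')) else s0.
by exists (fun i => sval (s i)) => i x; split=> //; exact: (svalP (step i (s i))).
Qed.

(** A chain map that vanishes on the resolved module is null-homotopic; the maps h
    in the proof form such a homotopy.  As they are R-linear they preserve torsion,
    hence kill the cohomology of the torsion functor as well. *)
Lemma homotopy M N e (Q : injectiveResolution M) (P : injectiveResolution N)
    (th : forall i, gmap (res_mod Q i) (res_mod P i) e) :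
    (forall i x, th i.+1 (res_d Q i x) = res_d P i (th i x)) ->
    (forall x, th 0%N (res_aug Q x) = 0) ->
  forall i (z : res_mod Q i), cocycles z -> coboundaries (th i z).
Proof.
move=> thd th0.
have H i : exists h : gmap (res_mod Q i.+1) (res_mod P i) e,
    forall x, th i.+1 (res_d Q i x) = res_d P i (h (res_d Q i x)).
  elim: i => [|i [h hE]].
    have [|x x0|h hE] := @injective_ext _ _ _ _ _ _ (res_gd Q 0) (th 0%N).
    - exact: res_injective.
    - have : range (res_aug Q) x by rewrite -res_exact0.
      by move=> [m _ <-].
    by exists h => x; rewrite thd; have /= -> := hE x.
  have gd : graded_of e (th i.+1 \- (res_d P i \o h)).
    move=> j x xj; apply: mdegB; first exact: gmap_deg.
    exact/res_d_graded/gmap_deg.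
  have [|x x0|h' h'E] := @injective_ext _ _ _ _ _ _ (res_gd Q i.+1) (Gmap gd).
  - exact: res_injective.
  - have : range (res_d Q i) x by rewrite -res_exact.
    by move=> [m _ <-] /=; rewrite hE subrr.
  exists h' => x; rewrite thd; have /= -> := h'E x.
  by rewrite linearB res_dd subr0.
move=> [|i] z [tz dz].
  have : range (res_aug Q) z by rewrite -res_exact0.
  by move=> [m _ <-]; exact: th0.
have : range (res_d Q i) z by rewrite -res_exact.
move=> [m _ mz]; have [h hE] := H i; exists (h z).
  exact: torsion_map.
by rewrite -mz hE.
Qed.

Lemma chain_map_coboundary M N e (Q : injectiveResolution M) (P : injectiveResolution N)
    (th : forall i, gmap (res_mod Q i) (res_mod P i) e) :
    (forall i x, th i.+1 (res_d Q i x) = res_d P i (th i x)) ->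
  forall i (z : res_mod Q i), coboundaries z -> coboundaries (th i z).
Proof.
move=> thd [|i] z; first by move=> -> /=; rewrite linear0.
by move=> [m tm <-]; exists (th i m); [exact: torsion_map|rewrite thd].
Qed.

Definition cocycle M i : set (cobar M i.+1) :=
  @cocycles k R M (cobar_resolution M) i.
Definition coboundary M i : set (cobar M i.+1) :=
  @coboundaries k R M (cobar_resolution M) i.
(** Nonvanishing of the i-th local cohomology in degree j, computed from the cobar
    resolution. *)
Definition nonzero_class M i j : Prop :=
  exists x : cobar M i.+1, [/\ mdeg j x, cocycle x & ~ coboundary x].

(** A class that survives in some resolution Q survives in the cobar resolution, as
    the composite Q -> cobar -> Q of two lifts of the identity is homotopic to the
    identity. *)
Lemma lc_nonzeroP M i j : lc_nonzero M i j <-> nonzero_class M i j.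
Proof.
split=> [[Q [x [xj [tx dx] nx]]]|[x hx]]; last by exists (cobar_resolution M), x.
have [phi phiP] := resolution_lift Q (cobar_resolution M).
have [psi psiP] := resolution_lift (cobar_resolution M) Q.
have phid i' y := (phiP i' y).1; have psid i' y := (psiP i' y).1.
have phi0 := (phiP 0%N 0).2; have psi0 := (psiP 0%N 0).2.
exists (phi i x); split.
- exact: gmap_deg0.
- split; first exact: torsion_map.
  change (res_d (cobar_resolution M) i (phi i x) = 0).
  by rewrite -phid dx linear0.
move=> bx; apply: nx.
have gd i' : graded_of 0 ((psi i' \o phi i') \- idfun).
  move=> j' y yj; rewrite addr0; apply: mdegB => //.
  exact/gmap_deg0/gmap_deg0.
rewrite -[x](subKr (psi i (phi i x))); apply: coboundariesB.
  exact: (chain_map_coboundary psid).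
apply: (homotopy (th := fun i' => Gmap (gd i'))) => [i' y|y|].
- by rewrite /= phid psid linearB.
- by rewrite /= phi0 psi0 subrr.
- by split.
Qed.

End Comparison.

(** * Functoriality of the cobar resolution *)

Section CobarFunctor.
Context {k : fieldType} {R : posGradedAlg k}.
Implicit Types (M X Y Z : gradedMod R) (e j : int).

Lemma post_klinear X Y (g : X -> Y) : klinear g ->
  klinear (fun phi : coind X => g (phi 1)).
Proof.
by move=> gL c x y; cbv beta; rewrite [X in g X](eval1_klinear c x y) gL.
Qed.

Lemma post_graded X Y e (g : X -> Y) : graded_of e g ->
  graded_of e (fun phi : coind X => g (phi 1)).
Proof. by move=> ge j x /eval1_deg /ge. Qed.

(** Functoriality of coinduction: composition with g.  Only k-linearity of g is
    asked, so that k-linear sections of surjections can be transported too. *)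
Definition coind_post X Y e (g : X -> Y) (gL : klinear g) (ge : graded_of e g) :
  gmap (coind X) (coind Y) e := coext (post_klinear gL) (post_graded ge).

Lemma coind_postE X Y e (g : X -> Y) (gL : klinear g) (ge : graded_of e g) phi r :
  coind_post gL ge phi r = g (phi r).
Proof. by have -> : phi r = (r *: phi : coind X) 1 by rewrite coindZE mulr1. Qed.

Fixpoint cobar_map X Y e (g : gmap X Y e) n : gmap (cobar X n) (cobar Y n) e :=
  if n is n'.+1 then
    coind_post (linear_klinear (cobar_map g n')) (gmap_deg (cobar_map g n'))
  else g.

Lemma cobar_mapSE X Y e (g : gmap X Y e) n (phi : cobar X n.+1) r :
  cobar_map g n.+1 phi r = cobar_map g n (phi r).
Proof. exact: coind_postE. Qed.

Lemma cobar_map_d X Y e (g : gmap X Y e) n x :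
  cobar_map g n.+1 (cobar_d X n x) = cobar_d Y n (cobar_map g n x).
Proof.
elim: n x => [|n IH] x; apply: coindP => r; rewrite cobar_mapSE.
  by rewrite !cobar_d0E linearZ.
by rewrite !cobar_dSE linearB linearZ IH cobar_mapSE.
Qed.

Lemma cobar_map_comp X Y Z e e1 e2 (g : gmap X Z e) (g1 : gmap X Y e1)
    (g2 : gmap Y Z e2) : (forall x, g x = g2 (g1 x)) ->
  forall n x, cobar_map g n x = cobar_map g2 n (cobar_map g1 n x).
Proof.
move=> E; elim=> [|n IH] x; first exact: E.
by apply: coindP => r; rewrite !cobar_mapSE IH.
Qed.

Lemma cobar_map_cocycle X Y e (g : gmap X Y e) i x :
  cocycle (M := X) (i := i) x -> cocycle (M := Y) (cobar_map g i.+1 x).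
Proof.
move=> [tx dx]; split; first exact: torsion_map.
change (cobar_d Y i.+1 (cobar_map g i.+1 x) = 0).
have {}dx : cobar_d X i.+1 x = 0 by exact: dx.
by rewrite -cobar_map_d dx linear0.
Qed.

Lemma cobar_map_coboundary X Y e (g : gmap X Y e) i x :
  coboundary (M := X) (i := i) x -> coboundary (M := Y) (cobar_map g i.+1 x).
Proof.
apply: (@chain_map_coboundary _ _ _ _ _ (cobar_resolution X) (cobar_resolution Y)
  (fun i => cobar_map g i.+1)) => i' y.
exact: cobar_map_d.
Qed.

Lemma coboundary0 X i : coboundary (0 : cobar X i.+1).
Proof. by case: i => [//|i]; exists 0; [exact: torsion0|exact: linear0]. Qed.

Lemma coboundaryB X i (x y : cobar X i.+1) : coboundary x ->
  coboundary y -> coboundary (x - y).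
Proof. exact: coboundariesB. Qed.

Lemma cocycleP X i (x : cobar X i.+1) :
  cocycle x <-> torsion x /\ cobar_d X i.+1 x = 0.
Proof. by []. Qed.

(** Powers of the irrelevant ideal are homogeneous, so whether one of them kills an
    element can be tested degree by degree. *)
Lemma torsion_mpart X (x : X) j : torsion x -> torsion (mpart x j).
Proof.
move=> [n h]; exists n => a Ja.
have Jc i := ideal_homog (hpartP (deg_grading R) a) Ja i.
apply: (hpart_ind (gG := deg_grading R) (S := fun b : R => b *: mpart x j = 0) (v := a)) => /=.
- exact: scale0r.
- by move=> u v u0 v0; rewrite scalerDl u0 v0 addr0.
move=> i; have bi : deg R i (hpart (deg_grading R) a i) by exact: hpart_in.
set b := hpart _ _ _ in bi Jc *.
rewrite -(@mpart_map _ _ X X i%:Z (fun y => b *: y)).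
- by rewrite h; [exact: hpart0|exact: Jc].
- by move=> y z; rewrite scalerDr.
- by move=> l y yl; rewrite addrC; exact: mdegZ.
Qed.

Lemma coboundary_homog X i j (x : cobar X i.+2) : mdeg j x -> coboundary (i := i.+1) x ->
  exists c : cobar X i.+1, [/\ mdeg j c, torsion c & cobar_d X i.+1 c = x].
Proof.
move=> xj [c tc dc]; exists (mpart c j); split; first exact: mpart_in.
  exact: torsion_mpart.
have {}dc : cobar_d X i.+1 c = x by [].
by rewrite -mpart_gmap addr0 dc mpart_homog.
Qed.

End CobarFunctor.

(** * Mayer-Vietoris squares *)

Section Square.
Context {k : fieldType} {R : posGradedAlg k}.
Implicit Types (A B X Y : gradedMod R) (e j : int).

(** Exactness of 0 -> A' -> A + B' -> B -> 0 for x |-> (p x, q x) and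
    (a, b) |-> r a - v b, with the middle term kept as two separate modules.  The
    surjectivity required of v alone is stronger than that of the second map; it
    lets lifts be taken in B'. *)
Record mv_square (A' A B' B : gradedMod R) e (p : gmap A' A 0) (q : gmap A' B' e)
    (r : gmap A B e) (v : gmap B' B 0) : Prop := MVSquare {
  sq_comm : forall x, r (p x) = v (q x);
  sq_inj : forall x, p x = 0 -> q x = 0 -> x = 0;
  sq_mid : forall a b, r a = v b -> exists x, p x = a /\ q x = b;
  sq_surj : forall b, exists b', v b' = b }.

(** A surjection of graded modules has a graded k-linear section, and composition
    with the section is R-linear on coinduced modules.  The R-linearity is what
    makes torsion elements lift to torsion elements. *)
Lemma coind_section X Y (v : gmap X Y 0) : (forall b, exists b', v b' = b) ->
  exists s : gmap (coind Y) (coind X) 0,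
    forall phi, coind_post (linear_klinear v) (gmap_deg v) (s phi) = phi.
Proof.
move=> vs; pose N := [set x | v x = 0].
have kN : ksubspace N.
  split; first exact: linear0.
  by move=> c x y x0 y0; rewrite /N /= linearP x0 y0 scaler0 addr0.
have hN : homogeneous N.
  by move=> x j x0; rewrite /N /= -mpart_gmap x0; exact: hpart0.
have [p [pL p0 pN Np]] := graded_projection kN hN.
have [h [hL hg hE]] := klinear_ext (u := v) pL p0 pN.
exists (coind_post hL hg) => phi; apply: coindP => r.
rewrite !coind_postE; have [x <-] := vs (phi r).
by rewrite hE; apply/esym/eqP; rewrite -subr_eq0 -linearB; apply/eqP/Np.
Qed.

Lemma sq_homog (A' A B' B : gradedMod R) e (p : gmap A' A 0) (q : gmap A' B' e)
    (r : gmap A B e) (v : gmap B' B 0) : mv_square p q r v ->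
  forall x j, mdeg j (p x) -> mdeg (j + e) (q x) -> mdeg j x.
Proof.
move=> sq x j pj qj; suff -> : x = mpart x j by exact: mpart_in.
apply/eqP; rewrite -subr_eq0; apply/eqP; apply: (sq_inj sq); rewrite linearB.
  by rewrite -mpart_gmap addr0 mpart_homog ?subrr.
by rewrite -mpart_gmap mpart_homog ?subrr.
Qed.

(** Solve in each degree and add up over a finite set of degrees supporting both
    arguments. *)
Lemma mid_of_homog (A' A B' B : gradedMod R) e (p : gmap A' A 0) (q : gmap A' B' e)
    (r : gmap A B e) (v : gmap B' B 0) :
  (forall j a b, mdeg j a -> mdeg (j + e) b -> r a = v b ->
     exists x, p x = a /\ q x = b) ->
  forall a b, r a = v b -> exists x, p x = a /\ q x = b.
Proof.
move=> H a b E.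
have X j : {x | p x = mpart a j /\ q x = mpart b (j + e)}.
  apply/cid/(H j); [exact: mpart_in|exact: mpart_in|].
  by rewrite -mpart_gmap E -mpart_gmap addr0.
have [_ [s [us cs ea]]] := (decompP _ _ _).1 (hpartP (mdeg_grading A) a).
have [_ [t [ut ct eb]]] := (decompP _ _ _).1 (hpartP (mdeg_grading B') b).
(* The components of b are indexed with the shift by e. *)
pose w := undup (s ++ [seq j - e | j <- t]).
exists (\sum_(j <- w) sval (X j)); split; rewrite linear_sum /=.
  under eq_bigr do rewrite (svalP (X _)).1.
  rewrite [RHS]ea; apply/esym/sum_undup_sub => //; last exact: undup_uniq.
  by move=> i; rewrite mem_undup mem_cat => ->.
under eq_bigr do rewrite (svalP (X _)).2.
have -> : \sum_(i <- w) mpart b (i + e) = \sum_(j <- [seq i + e | i <- w]) mpart b j.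
  by rewrite big_map.
rewrite [RHS]eb; apply/esym/sum_undup_sub => //.
  move=> i ti; apply/mapP; exists (i - e); rewrite ?subrK //.
  rewrite mem_undup mem_cat; apply/orP; right.
  by apply/mapP; exists i.
by rewrite map_inj_uniq ?undup_uniq //; exact: addIr.
Qed.

(** Coinduction is exact.  In the middle, the maps p and q being jointly injective,
    the pointwise solutions are unique and therefore assemble into a k-linear
    map. *)
Lemma coind_square (A' A B' B : gradedMod R) e (p : gmap A' A 0) (q : gmap A' B' e)
    (r : gmap A B e) (v : gmap B' B 0) : mv_square p q r v ->
  mv_square (coind_post (linear_klinear p) (gmap_deg p))
    (coind_post (linear_klinear q) (gmap_deg q))
    (coind_post (linear_klinear r) (gmap_deg r))
    (coind_post (linear_klinear v) (gmap_deg v)).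
Proof.
move=> sq; split.
- by move=> x; apply: coindP => s; rewrite !coind_postE; exact: sq_comm sq _.
- move=> x px qx; apply: coindP => s; apply: (sq_inj sq).
    by rewrite -(coind_postE (linear_klinear p) (gmap_deg p)) px.
  by rewrite -(coind_postE (linear_klinear q) (gmap_deg q)) qx.
- apply: mid_of_homog => j a b aj bj E.
  have X s : {x | p x = a s /\ q x = b s}.
    apply/cid/(sq_mid sq).
    rewrite -(coind_postE (linear_klinear r) (gmap_deg r)) E.
    by rewrite coind_postE.
  have uniq_ext x y : p x = p y -> q x = q y -> x = y.
    move=> pE qE; apply/eqP; rewrite -subr_eq0; apply/eqP; apply: (sq_inj sq).
      by rewrite linearB pE subrr.
    by rewrite linearB qE subrr.
  have xh : coind_hom j (fun s => sval (X s)).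
    split=> [c s t|i s si].
      apply: uniq_ext; rewrite linearP ?(svalP (X _)).1 ?(svalP (X _)).2.
        exact: (coind_klinear a).
      exact: (coind_klinear b).
    apply: (sq_homog sq); rewrite ?(svalP (X _)).1 ?(svalP (X _)).2.
      by case: aj => _; exact.
    by rewrite -addrA; case: bj => _; exact.
  exists (Coind (coind_hom_in xh)); split; apply: coindP => s;
    by rewrite coind_postE /= ?(svalP (X _)).1 ?(svalP (X _)).2.
- by move=> b; have [s sE] := coind_section (sq_surj sq); exists (s b).
Qed.

Lemma cobar_square (A' A B' B : gradedMod R) e (p : gmap A' A 0) (q : gmap A' B' e)
    (r : gmap A B e) (v : gmap B' B 0) n : mv_square p q r v ->
  mv_square (cobar_map p n) (cobar_map q n) (cobar_map r n) (cobar_map v n).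
Proof. by move=> sq; elim: n => //= n IH; exact: coind_square. Qed.

Section Exactness.
Variables (A' A B' B : gradedMod R) (e : int).
Variables (p : gmap A' A 0) (q : gmap A' B' e) (r : gmap A B e) (v : gmap B' B 0).
Hypothesis sq : mv_square p q r v.

Let ksq n := cobar_square n sq.

Lemma sq_lift n : exists s : gmap (cobar B n.+1) (cobar B' n.+1) 0,
  forall b, cobar_map v n.+1 (s b) = b.
Proof. exact: (coind_section (sq_surj (ksq n))). Qed.

Lemma sq_uniq n x y : cobar_map p n x = cobar_map p n y ->
  cobar_map q n x = cobar_map q n y -> x = y.
Proof.
move=> pE qE; apply/eqP; rewrite -subr_eq0; apply/eqP; apply: (sq_inj (ksq n)).
  by rewrite linearB pE subrr.
by rewrite linearB qE subrr.
Qed.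

Lemma sq_torsion n x : torsion (cobar_map p n x) -> torsion (cobar_map q n x) ->
  torsion x.
Proof.
move=> [m hp] [l hq]; exists (m + l)%N => a Ja; apply: (sq_inj (ksq n)).
  by rewrite linearZ_LR hp //; apply: ideal_pow_le Ja; rewrite leq_addr.
by rewrite linearZ_LR hq //; apply: ideal_pow_le Ja; rewrite leq_addl.
Qed.

Lemma sq_cocycle i (x : cobar A' i.+1) : cocycle (cobar_map p i.+1 x) ->
  cocycle (cobar_map q i.+1 x) -> cocycle x.
Proof.
move=> /cocycleP[tp dp] /cocycleP[tq dq]; apply/cocycleP; split; first exact: sq_torsion.
by apply: sq_uniq; rewrite cobar_map_d ?dp ?dq linear0.
Qed.

(** The torsion cochain whose boundary is y lifts along the surjection v, so the
    lift of y can be taken to be a boundary. *)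
Lemma coboundary_lift i j (y : cobar B i.+1) : mdeg j y -> coboundary y ->
  exists b : cobar B' i.+1, [/\ mdeg j b, cocycle b, coboundary b & cobar_map v i.+1 b = y].
Proof.
case: i y => [|i] y yj by_.
  have -> : y = 0 by exact: by_.
  exists 0; split; [exact: mdeg0| |by []|exact: linear0].
  by apply/cocycleP; split; [exact: torsion0|exact: linear0].
have [c [cj tc dc]] := coboundary_homog yj by_.
have [s sE] := sq_lift i.
exists (cobar_d B' i.+1 (s c)); split.
- exact/gmap_deg0/gmap_deg0.
- by apply/cocycleP; split; [exact/torsion_map/torsion_map|exact: cobar_dd].
- by exists (s c) => //; exact: torsion_map.
- by rewrite cobar_map_d sE.
Qed.

(** Exactness of H^i(A') -> H^i(A) + H^i(B') -> H^i(B) at the pair (x, 0). *)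
Lemma sq_exact_A i j (x : cobar A i.+1) : mdeg j x -> cocycle x ->
    coboundary (cobar_map r i.+1 x) ->
  exists w : cobar A' i.+1, [/\ mdeg j w, cocycle w & cobar_map p i.+1 w = x].
Proof.
move=> xj cx brx.
have [b [bj cb _ vb]] := coboundary_lift (gmap_deg _ xj) brx.
have [w [pw qw]] := sq_mid (ksq i.+1) (esym vb).
exists w; split=> //; last by apply: sq_cocycle; rewrite ?pw ?qw.
by apply: (sq_homog (ksq i.+1)); rewrite ?pw ?qw.
Qed.

(** Exactness of H^i(A) + H^i(B') -> H^i(B) -> H^(i+1)(A'). *)
Lemma sq_exact_B i j : nonzero_class B i (j + e) ->
  [\/ nonzero_class A' i.+1 j, nonzero_class A i j | nonzero_class B' i (j + e)].
Proof.
move=> [z [zj cz nz]]; apply: contrapT => nh.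
have [s sE] := sq_lift i; pose y := s z.
have [tz dz] := (cocycleP _).1 cz.
have yj : mdeg (j + e) y by exact: gmap_deg0.
have [w [pw qw]] : exists w, cobar_map p i.+2 w = 0 /\
    cobar_map q i.+2 w = cobar_d B' i.+1 y.
  by apply: (sq_mid (ksq i.+2)); rewrite linear0 cobar_map_d sE dz.
have wj : mdeg j w.
  apply: (sq_homog (ksq i.+2)); rewrite ?pw ?qw; first exact: mdeg0.
  exact: gmap_deg0.
have cw : cocycle w.
  apply: sq_cocycle; rewrite ?pw ?qw; apply/cocycleP.
    by split; [exact: torsion0|exact: linear0].
  by split; [exact/torsion_map/torsion_map|exact: cobar_dd].
have bw : coboundary w.
  by apply: contrapT => nb; apply: nh; apply: Or31; exists w.
have [x [xj tx dx]] := coboundary_homog wj bw.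
have bpx : coboundary (cobar_map p i.+1 x).
  apply: contrapT => nb; apply: nh; apply: Or32; exists (cobar_map p i.+1 x).
  split=> //; first exact: gmap_deg0.
  by apply/cocycleP; split; [exact: torsion_map|rewrite -cobar_map_d dx pw].
have bqx : coboundary (cobar_map q i.+1 x - y).
  apply: contrapT => nb; apply: nh; apply: Or33.
  exists (cobar_map q i.+1 x - y); split=> //.
    by apply: mdegB => //; exact: gmap_deg.
  apply/cocycleP; split; first by apply: torsionB; exact: torsion_map.
  by rewrite linearB -cobar_map_d dx qw subrr.
apply: nz; rewrite (_ : z = cobar_map r i.+1 (cobar_map p i.+1 x)
  - cobar_map v i.+1 (cobar_map q i.+1 x - y)).
  by apply: coboundaryB; exact: cobar_map_coboundary.
by rewrite linearB sE (sq_comm (ksq i.+1)) opprB addrC subrK.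
Qed.

(** Exactness of H^(i-1)(B) -> H^i(A') -> H^i(A) + H^i(B').  For i = 0 the second
    map is injective and there is no such class. *)
Lemma sq_exact_A' i j (w : cobar A' i.+1) : mdeg j w -> cocycle w -> ~ coboundary w ->
    coboundary (cobar_map p i.+1 w) -> coboundary (cobar_map q i.+1 w) ->
  exists2 i', i = i'.+1 & nonzero_class B i' (j + e).
Proof.
case: i w => [|i] w wj cw nw bp bq.
  by case: nw; apply: (sq_inj (ksq 1)).
exists i => //.
have [y1 [y1j t1 d1]] := coboundary_homog (gmap_deg0 _ wj) bp.
have [y2 [y2j t2 d2]] := coboundary_homog (gmap_deg _ wj) bq.
have zj : mdeg (j + e) (cobar_map r i.+1 y1 - cobar_map v i.+1 y2).
  by apply: mdegB; [exact: gmap_deg|exact: gmap_deg0].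
exists (cobar_map r i.+1 y1 - cobar_map v i.+1 y2); split=> //.
  apply/cocycleP; split; first by apply: torsionB; exact: torsion_map.
  by rewrite linearB -!cobar_map_d d1 d2 (sq_comm (ksq i.+2)) subrr.
move=> /(coboundary_lift zj)[b [_ /cocycleP[tb db] _ vb]]; apply: nw.
have [x [px qx]] : exists x, cobar_map p i.+1 x = y1 /\
    cobar_map q i.+1 x = y2 + b.
  by apply: (sq_mid (ksq i.+1)); rewrite linearD vb addrC subrK.
exists x.
  apply: sq_torsion; rewrite ?px ?qx //.
  by rewrite -[b]opprK -[- b]sub0r; do 2?apply: torsionB => //; exact: torsion0.
change (cobar_d A' i.+1 x = w).
by apply: sq_uniq; rewrite cobar_map_d ?px ?qx // linearD db addr0.
Qed.

End Exactness.
End Square.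

(** * Classes killed by a form of positive degree *)

Section TorsionClass.
Context {k : fieldType} {R : posGradedAlg k}.
Variables (M : gradedMod R) (f : R) (d : nat) (hf : deg R d f).

Lemma scale_graded (X : gradedMod R) : graded_of d%:Z ( *:%R f : X -> X).
Proof. by move=> j x xj; rewrite addrC; exact: mdegZ. Qed.

Definition scale_gmap (X : gradedMod R) : gmap X X d := Gmap (@scale_graded X).

(** The module action of f on the cobar resolution and the map induced by the
    endomorphism f of M differ, but both lift the same endomorphism. *)
Lemma scale_homotopy i (z : cobar M i.+1) : cocycle z ->
  coboundary (f *: z - cobar_map (scale_gmap M) i.+1 z).
Proof.
move=> cz; pose th i := *:%R f \- cobar_map (scale_gmap M) i.+1.
have thg i' : graded_of d (th i').
  by move=> j x xj; apply: mdegB; [exact: scale_graded|exact: gmap_deg].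
apply: (@homotopy _ _ _ _ _ (cobar_resolution M) (cobar_resolution M)
  (fun i => Gmap (thg i))) cz => [i' x|x] /=.
  change (f *: cobar_d M i'.+1 x - cobar_map (scale_gmap M) i'.+2 (cobar_d M i'.+1 x)
    = cobar_d M i'.+1 (f *: x - cobar_map (scale_gmap M) i'.+1 x)).
  by rewrite cobar_map_d linearB linearZ.
change (f *: cobar_d M 0 x - cobar_map (scale_gmap M) 1 (cobar_d M 0 x) = 0).
by rewrite cobar_map_d -linearZ subrr.
Qed.

Hypothesis d_gt0 : (0 < d)%N.

Lemma expr_irrelevant n : ideal_set (ideal_pow (irrelevant R) n) (f ^+ n).
Proof.
elim: n => [//|n IH]; rewrite exprS; apply: ideal_mul_in => //.
exists (fun l => if l == d then f else 0).
  exact: (decomp_homog (deg_grading R)).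
by case: eqP => // d0; have := d_gt0; rewrite -d0.
Qed.

Lemma deg_expr n : deg R (n * d) (f ^+ n).
Proof.
elim: n => [|n IH]; last by rewrite exprS mulSn; exact: degM.
by rewrite deg_0; exists 1 => //; rewrite scale1r.
Qed.

(** A class is represented by a torsion cocycle, so some power of f kills it; take
    the largest power that does not. *)
Lemma killed_class i j : nonzero_class M i j ->
  exists n (w : cobar M i.+1), [/\ mdeg (j + (n * d)%:Z) w, cocycle w, ~ coboundary w
    & coboundary (cobar_map (scale_gmap M) i.+1 w)].
Proof.
move=> [x [xj cx nx]]; have [[m hm] dx] := (cocycleP _).1 cx.
have ex : exists n, `[< coboundary (f ^+ n *: x) >].
  exists m; apply/asboolP; rewrite hm; last exact: expr_irrelevant.
  exact: coboundary0.
case: (ex_minnP ex) => -[|n] /asboolP bn nmin.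
  by case: nx; move: bn; rewrite scale1r.
exists n, (f ^+ n *: x).
have cw : cocycle (f ^+ n *: x).
  apply/cocycleP; split; last by rewrite linearZ_LR dx scaler0.
  exact: (torsion_map ( *:%R (f ^+ n)) ((cocycleP _).1 cx).1).
split=> //.
- by rewrite addrC; apply: mdegZ => //; exact: deg_expr.
- by move=> bw; have := nmin n (asboolT bw); rewrite ltnn.
- have := coboundaryB bn (scale_homotopy cw).
  by rewrite scalerA -exprS opprB addrC subrK.
Qed.

End TorsionClass.

(** * Extrema of sets of extended integers *)

Section ExtendedIntegers.

Lemma infimum_nat (A : set nat) : A !=set0 -> exists m : nat,
  [/\ A m, forall i, A i -> (m <= i)%N
    & infimum +oo%E [set (Posz i)%:E | i in A] = (Posz m)%:E].
Proof.
move=> [a Aa]; have ex : exists n, `[< A n >] by exists a; apply/asboolP.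
case: (ex_minnP ex) => m /asboolP Am mmin.
have {}mmin i : A i -> (m <= i)%N by move=> Ai; apply/mmin/asboolP.
exists m; split=> //; rewrite /infimum ifF; last first.
  by apply/negbTE/set0P; exists (Posz m)%:E, m.
apply: xget_subset1; last exact: is_subset1_infimums.
split.
  by move=> _ [i /mmin mi <-]; rewrite lee_fin lez_nat.
by move=> y; apply; exists m.
Qed.

Lemma infimum_nat_le (A B : set nat) : A `<=` B ->
  (infimum +oo%E [set (Posz i)%:E | i in B] <=
   infimum +oo%E [set (Posz i)%:E | i in A] :> \bar int)%E.
Proof.
move=> AB; have [->|/set0P nA] := eqVneq A set0.
  by rewrite image_set0 {2}/infimum eqxx leey.
have [m [Am _ ->]] := infimum_nat nA.
have [n [_ nmin ->]] : exists n : nat, [/\ B n, forall i, B i -> (n <= i)%N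
    & infimum +oo%E [set (Posz i)%:E | i in B] = (Posz n)%:E].
  by apply: infimum_nat; case: nA => x /AB; exists x.
by rewrite lee_fin lez_nat; apply/nmin/AB.
Qed.

(** A set of integers has a supremum among the extended integers, namely its
    maximum or +oo; the order on extended integers alone does not give one. *)
Lemma supremum_int (x0 : \bar int) (A : set int) : A !=set0 ->
  supremums [set x%:E | x in A] (supremum x0 [set x%:E | x in A]).
Proof.
move=> nA; have [a Aa] := nA.
rewrite /supremum ifF; last by apply/negbTE/set0P; exists a%:E, a.
suff [s hs] : supremums [set x%:E | x in A] !=set0 by exact: xgetI hs.
have [[b hb]|nb] := pselect (exists b, forall x, A x -> x <= b).
  have ex : exists n : nat, `[< A (b - n%:Z) >].
    exists `|b - a|%N; apply/asboolP; have := hb _ Aa => ab.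
    by rewrite (_ : b - _ = a) //; lia.
  case: (ex_minnP ex) => n /asboolP An nmin; exists (b - n%:Z)%:E; split.
    move=> _ [x Ax <-]; rewrite lee_fin.
    have xb := hb _ Ax; have := nmin `|b - x|%N.
    rewrite (_ : b - `|b - x|%N%:Z = x); last by lia.
    by move=> /(_ (asboolT Ax)); lia.
  by move=> y; apply; exists (b - n%:Z).
(* Without an integer bound, +oo is the only upper bound. *)
exists +oo%E; split=> [x _|[y| |] hy]; rewrite ?leey //.
  by case: nb; exists y => x Ax; rewrite -lee_fin; apply: hy; exists x.
by have := hy a%:E; rewrite leeNy_eq => /(_ (ex_intro2 _ _ a Aa erefl)).
Qed.

Lemma supremum_int_le (A B : set int) (s t : int) :
  (forall x, A x -> exists2 y, B y & x + (t - s) <= y) ->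
  (supremum -oo%E [set x%:E | x in A] - s%:E <=
   supremum -oo%E [set x%:E | x in B] - t%:E :> \bar int)%E.
Proof.
move=> AB; have [->|/set0P nA] := eqVneq A set0.
  by rewrite image_set0 supremum0 leNye.
have nB : B !=set0 by case: nA => x /AB[y By _]; exists y.
have [_ lA] := supremum_int -oo%E nA; have [uB _] := supremum_int -oo%E nB.
set SA := supremum _ _ in lA *; set SB := supremum _ _ in uB *.
have : (SA <= SB - (t - s)%:E)%E.
  apply: lA => _ [x /AB[y By xy] <-]; have := uB y%:E (ex_intro2 _ _ y By erefl).
  by case: (SB) => [z| |] //=; rewrite -?EFinB ?lee_fin ?leey //; lia.
case: (SA) (SB) => [x| |] [y| |] //=; rewrite -?EFinB ?lee_fin ?leey ?leNye //; lia.
Qed.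

End ExtendedIntegers.

(** * Maps between cyclic modules *)

Section QuotientMaps.
Context {k : fieldType} {R : posGradedAlg k}.
Implicit Types X Y : gradedIdeal R.

Lemma residue_class0 X (r : R) : residue_class X r = 0 <-> ideal_set X r.
Proof.
have E : residue_class X 0 = 0 by rewrite -(subrr 0) residue_classB subrr.
rewrite -{1}E -{2}[r]subr0; exact: residue_class_eq.
Qed.

Section Mul.
Variables (X Y : gradedIdeal R) (g : R) (e : nat) (ge : deg R e g).
Hypothesis gXY : forall x, ideal_set X x -> ideal_set Y (g * x).

Definition qmul_fun (x : quotient_mod X) : quotient_mod Y :=
  residue_class Y (g * repr (x : residue X)).

Lemma qmul_funE r : qmul_fun (residue_class X r) = residue_class Y (g * r).
Proof.
apply/residue_class_eq; rewrite -mulrBr; apply: gXY.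
by apply/residue_class_eq; rewrite /residue_class reprK.
Qed.

Lemma qmul_linear : linear qmul_fun.
Proof.
move=> a x y; have [r ->] := residue_classP x; have [s ->] := residue_classP y.
have E (Z : gradedIdeal R) u v : a *: residue_class Z u + residue_class Z v
    = residue_class Z (a * u + v).
  by rewrite residue_classD -residue_scaleE.
by rewrite [X in qmul_fun X]E !qmul_funE E mulrDr mulrCA.
Qed.
HB.instance Definition _ := GRing.isLinear.Build R (quotient_mod X) (quotient_mod Y)
  *:%R qmul_fun qmul_linear.

Lemma qmul_graded : graded_of e qmul_fun.
Proof.
move=> [i|n] x; last by move=> ->; rewrite linear0; exact: mdeg0.
move=> [r ri <-]; rewrite qmul_funE addrC; exists (g * r) => //; exact: degM.
Qed.

Definition qmul : gmap (quotient_mod X) (quotient_mod Y) e := Gmap qmul_graded.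

Lemma qmulE r : qmul (residue_class X r) = residue_class Y (g * r).
Proof. exact: qmul_funE. Qed.
End Mul.

Lemma sub_mul1 X Y : ideal_set X `<=` ideal_set Y ->
  forall x, ideal_set X x -> ideal_set Y (1 * x).
Proof. by move=> XY x /XY; rewrite mul1r. Qed.

Definition qproj X Y (XY : ideal_set X `<=` ideal_set Y) :
  gmap (quotient_mod X) (quotient_mod Y) 0 := qmul (@deg_one k R) (sub_mul1 XY).

Lemma qprojE X Y (XY : ideal_set X `<=` ideal_set Y) r :
  qproj XY (residue_class X r) = residue_class Y r.
Proof. by rewrite qmulE mul1r. Qed.

(** The two conditions on ideals say that A' = A :&: (B' : g) and B = B' + g A. *)
Lemma quotient_square (A' A B' B : gradedIdeal R) (g : R) (e : nat)
    (ge : deg R e g) (sA : ideal_set A' `<=` ideal_set A)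
    (sB : ideal_set B' `<=` ideal_set B)
    (gA' : forall x, ideal_set A' x -> ideal_set B' (g * x))
    (gA : forall x, ideal_set A x -> ideal_set B (g * x)) :
  (forall x, ideal_set A x -> ideal_set B' (g * x) -> ideal_set A' x) ->
  (forall x, ideal_set B x ->
     exists b z, [/\ ideal_set B' b, ideal_set A z & x = b + g * z]) ->
  mv_square (qproj sA) (qmul ge gA') (qmul ge gA) (qproj sB).
Proof.
move=> inj gen; split.
- move=> x; have [r ->] := residue_classP x; rewrite qprojE [LHS]qmulE.
  by rewrite [X in _ = qproj _ X]qmulE qprojE.
- move=> x; have [r ->] := residue_classP x; rewrite qprojE qmulE.
  by move=> /residue_class0 ? /residue_class0 ?; apply/residue_class0/inj.
- move=> a b; have [r ->] := residue_classP a; have [s ->] := residue_classP b.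
  rewrite qmulE qprojE => /residue_class_eq/gen[y [z [By Az E]]].
  exists (residue_class A' (r - z)); rewrite qprojE qmulE; split.
    apply/residue_class_eq; rewrite addrAC subrr sub0r -[- z]sub0r.
    by apply: idealB => //; [exact: ideal_ideal|exact: (ideal0 (ideal_ideal A))].
  apply/residue_class_eq; rewrite mulrBr addrAC E addrK //.
- move=> b; have [s ->] := residue_classP b; exists (residue_class B' s).
  exact: qprojE.
Qed.

End QuotientMaps.

(** * Powers of an ideal enlarged by a regular form *)

Section Powers.
Context {k : fieldType} {R : posGradedAlg k}.
Variables (I : gradedIdeal R) (f : R) (d : nat) (hf : deg R d f).
Hypothesis hreg : forall t, nonzerodivisor f (quotient_mod (ideal_pow I t)).

Let J := ideal_add I (principal hf).
Let In t := ideal_set (ideal_pow I t).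
Let Jn t := ideal_set (ideal_pow J t).
Let W a n := ideal_mul (ideal_pow I a.+1) (ideal_pow J n).

Let iI t : is_ideal (In t) := ideal_ideal (ideal_pow I t).
Let iJ t : is_ideal (Jn t) := ideal_ideal (ideal_pow J t).
Let iW a n : is_ideal (ideal_set (W a n)) := ideal_ideal (W a n).

Lemma base_in_sum x : ideal_set I x -> ideal_set J x.
Proof.
move=> Ix; exists x => //; exists 0; last by rewrite addr0.
exact: (ideal0 (principal_ideal f)).
Qed.

Lemma form_in_sum : ideal_set J f.
Proof.
exists 0; first exact: (ideal0 (ideal_ideal I)).
by exists f; [exists 1 => //; rewrite mul1r|rewrite add0r].
Qed.

Lemma base_pow_sub t : In t `<=` Jn t.
Proof.
elim: t => [//|t IH]; apply: ideal_mul_sub => [|a b Ia /IH Jb]; first exact: iJ.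
by apply: ideal_mul_in => //; exact: base_in_sum.
Qed.

Lemma form_pow n : Jn n (f ^+ n).
Proof.
by elim: n => [//|n IH]; rewrite exprS; apply: ideal_mul_in => //; exact: form_in_sum.
Qed.

Lemma pow_mul m n u v : Jn m u -> Jn n v -> Jn (m + n) (u * v).
Proof.
elim: m u v => [|m IH] u v Ju Jv; first exact: (idealM (iJ _)).
have iS : is_ideal [set u | Jn (m.+1 + n) (u * v)].
  split=> [|a x y hx hy] /=; first by rewrite mul0r; exact: (ideal0 (iJ _)).
  by rewrite mulrDl -mulrA; exact: (iJ _).2.
apply: (ideal_mul_sub iS _ Ju) => a b Ja Jb /=.
by rewrite -mulrA addSn; apply: ideal_mul_in => //; exact: IH.
Qed.

Lemma form_mul_pow a n x : Jn a x -> Jn (a + n) (f ^+ n * x).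
Proof. by move=> Jx; rewrite mulrC; apply: pow_mul => //; exact: form_pow. Qed.

Lemma W_sub a n : ideal_set (W a n) `<=` Jn (a + n.+1).
Proof.
apply: ideal_mul_sub => [|x y Ix Jy]; first exact: iJ.
by rewrite addnS -addSn; apply: pow_mul => //; exact: base_pow_sub.
Qed.

Lemma form_mul_W a n x : In a.+1 x -> ideal_set (W a n) (f ^+ n * x).
Proof. by move=> Ix; rewrite mulrC; apply: ideal_mul_in => //; exact: form_pow. Qed.

(** Expand J J^a = I J^a + f J^a and use the induction hypothesis on J^a in the
    first summand. *)
Lemma sum_pow_decomp1 a x : Jn a.+1 x ->
  exists u v, [/\ In a.+1 u, Jn a v & x = u + f * v].
Proof.
pose S a := [set x | exists u v, [/\ In a.+1 u, Jn a v & x = u + f * v]].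
have iS b : is_ideal (S b).
  split=> [|r _ _ [u [v [Iu Jv ->]]] [u' [v' [Iu' Jv' ->]]]].
    exists 0, 0; rewrite mulr0 addr0.
    by split=> //; [exact: (ideal0 (iI _))|exact: (ideal0 (iJ _))].
  exists (r * u + u'), (r * v + v'); split; [exact: (iI _).2|exact: (iJ _).2|].
  by rewrite !mulrDr addrACA mulrCA.
suff H : Jn a.+1 `<=` S a by exact: H.
elim: a {x} => [|a IH]; apply: (ideal_mul_sub (iS _)) => _ y [i Ii [_ [c _ <-] ->]] Jy.
  exists (i * y), (c * y); split=> //; last by rewrite mulrDl (mulrC c f) -mulrA.
  exact: ideal_mul_in.
have [u [v [Iu Jv yE]]] := IH _ Jy.
exists (i * u), (i * v + c * y); split.
- exact: ideal_mul_in.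
- apply: (idealD (iJ _)); last exact: (idealM (iJ _)).
  by apply: ideal_mul_in => //; exact: base_in_sum.
- by rewrite mulrDl (mulrC c f) -mulrA {1}yE !mulrDr (mulrCA i f) addrA.
Qed.

(** Multiply the decomposition of J^(a+m) by J and split the new factor
    J J^a = J^(a+1) once more; the part f^m I^(a+1) is absorbed by the first
    summand because f^m is in J^m. *)
Lemma sum_pow_decomp a n x : Jn (a + n.+1) x ->
  exists u v, [/\ ideal_set (W a n) u, Jn a v & x = u + f ^+ n.+1 * v].
Proof.
pose S n := [set x | exists u v,
  [/\ ideal_set (W a n) u, Jn a v & x = u + f ^+ n.+1 * v]].
have iS b : is_ideal (S b).
  split=> [|r _ _ [u [v [Iu Jv ->]]] [u' [v' [Iu' Jv' ->]]]].
    exists 0, 0; rewrite mulr0 addr0.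
    by split=> //; [exact: (ideal0 (iW _ _))|exact: (ideal0 (iJ _))].
  exists (r * u + u'), (r * v + v'); split; [exact: (iW _ _).2|exact: (iJ _).2|].
  by rewrite !mulrDr addrACA mulrCA.
suff H : Jn (a + n.+1) `<=` S n by exact: H.
elim: n {x} => [|n IH].
  rewrite addn1 => x /sum_pow_decomp1[u [v [Iu Jv ->]]]; exists u, v; split=> //.
  by rewrite -[u]mulr1; apply: ideal_mul_in.
rewrite addnS; apply: (ideal_mul_sub (iS _)) => x y Jx /IH[u [v [Wu Jv ->]]].
have [u' [v' [Iu' Jv' xv]]] : exists u' v', [/\ In a.+1 u', Jn a v' & x * v = u' + f * v'].
  by apply: sum_pow_decomp1; exact: ideal_mul_in.
exists (x * u + f ^+ n.+1 * u'), v'; split=> //.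
  apply: (idealD (iW _ _)); last exact: form_mul_W.
  have iS' : is_ideal [set u | ideal_set (W a n.+1) (x * u)].
    split=> [|r w w' hw hw'].
      change (ideal_set (W a n.+1) (x * 0)); rewrite mulr0.
      exact: (ideal0 (iW a n.+1)).
    change (ideal_set (W a n.+1) (x * (r * w + w'))); rewrite mulrDr mulrCA.
    exact: (iW a n.+1).2.
  apply: (ideal_mul_sub iS' _ Wu) => b c Ib Jc.
  change (ideal_set (W a n.+1) (x * (b * c))).
  by rewrite mulrCA; apply: ideal_mul_in => //; exact: ideal_mul_in.
by rewrite mulrDr mulrCA xv mulrDr addrA (exprSr f n.+1) mulrA.
Qed.

Lemma form_regular t x : In t (f * x) -> In t x.
Proof.
move=> /residue_class0; rewrite -residue_scaleE => /(hreg (t := t)).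
by move/residue_class0.
Qed.

Lemma form_pow_regular t n x : In t (f ^+ n * x) -> In t x.
Proof.
elim: n => [|n IH]; first by rewrite mul1r.
by rewrite exprS -mulrA => /form_regular.
Qed.

Lemma base_sub_sum a : In a.+1 `<=` Jn a.
Proof. by move=> x /ideal_mul_subr/base_pow_sub. Qed.

Let Q X := quotient_mod (R := R) X.
Let M t := Q (ideal_pow J t).

Lemma form_base x a : In a x -> In a (f * x).
Proof. exact: (idealM (iI _)). Qed.

Lemma form_sum a x : Jn a x -> Jn a.+1 (f * x).
Proof. by move=> Jx; apply: ideal_mul_in => //; exact: form_in_sum. Qed.

Lemma step_square a :
  mv_square (qproj (@base_sub_sum a)) (qmul hf (fun x => @form_base x a.+1))
    (qmul hf (@form_sum a)) (qproj (@base_pow_sub a.+1)).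
Proof.
apply: quotient_square => [x _|x]; first exact: form_regular.
exact: sum_pow_decomp1.
Qed.

Lemma form_mul_W1 a n x : In a.+1 x -> ideal_set (W a n) (f ^+ n.+1 * x).
Proof. by move=> Ix; rewrite exprSr -mulrA; apply: form_mul_W; exact: form_base. Qed.

Lemma long_square a n :
  mv_square (qproj (@base_sub_sum a))
    (qmul (deg_expr hf n.+1) (@form_mul_W1 a n))
    (qmul (deg_expr hf n.+1) (@form_mul_pow a n.+1)) (qproj (@W_sub a n)).
Proof.
apply: quotient_square => [x _|x]; last exact: sum_pow_decomp.
by move=> /ideal_mul_subl; exact: form_pow_regular.
Qed.

(** If f kills the class, it lifts to a class of R/I^(a+1), which is nonzero in
    R/J^(a+1) because the projection to R/J^a factors through R/J^(a+1). *)
Lemma nonzero_class_succ a i j : nonzero_class (M a) i j ->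
  nonzero_class (M a.+1) i j \/ nonzero_class (M a.+1) i (j + d).
Proof.
move=> [x [xj cx nx]].
have [bx|nbx] := pselect (coboundary (cobar_map (qmul hf (@form_sum a)) i.+1 x)); last first.
  by right; exists (cobar_map (qmul hf (@form_sum a)) i.+1 x); split=> //;
    [exact: gmap_deg|exact: cobar_map_cocycle].
have [w [wj cw wx]] := sq_exact_A (step_square a) xj cx bx.
left; exists (cobar_map (qproj (@base_pow_sub a.+1)) i.+1 w); split.
- exact: gmap_deg0.
- exact: cobar_map_cocycle.
(* The composite of this projection with the previous one is R/I^(a+1) -> R/J^a. *)
pose pr := qproj (@ideal_pow_le _ _ J _ _ (leqnSn a)).
move=> /(cobar_map_coboundary pr); rewrite /pr -(cobar_map_comp (g := qproj (@base_sub_sum a))).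
  by rewrite wx.
by move=> y; have [r ->] := residue_classP y; rewrite !qprojE.
Qed.

Hypothesis d_gt0 : (0 < d)%N.

(** Multiply the class by a power of f until f kills it.  If its image in R/J^a
    vanishes, it is a connecting image from R/J^(a+m), m = n + 1: its image in R/W
    vanishes since f^m is f^n after the multiplication by f on R/I^(a+1). *)
Lemma nonzero_class_base a n i j : nonzero_class (Q (ideal_pow I a.+1)) i j ->
  exists2 j', j <= j' & nonzero_class (M a) i j' \/
    exists2 i', i = i'.+1 & nonzero_class (M (a + n.+1)) i' (j' + (n.+1 * d)%:Z).
Proof.
move=> /(killed_class hf d_gt0)[l [w [wj cw nw bw]]].
exists (j + (l * d)%:Z); first by lia.
have [bpw|nb] := pselect (coboundary (cobar_map (qproj (@base_sub_sum a)) i.+1 w)); last first.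
  by left; exists (cobar_map (qproj (@base_sub_sum a)) i.+1 w); split=> //;
    [exact: gmap_deg0|exact: cobar_map_cocycle].
right; apply: (sq_exact_A' (long_square a n) wj cw nw bpw).
pose g := qmul (deg_expr hf n) (@form_mul_W a n).
rewrite (cobar_map_comp (g1 := scale_gmap hf _) (g2 := g)); first exact: cobar_map_coboundary.
move=> y; have [r ->] := residue_classP y.
have -> : scale_gmap hf (Q (ideal_pow I a.+1)) (residue_class _ r) =
    residue_class (ideal_pow I a.+1) (f * r).
  exact: residue_scaleE.
by rewrite /g !qmulE exprSr mulrA.
Qed.

Lemma nonzero_class_unit i j : ~ nonzero_class (M 0) i j.
Proof.
have z n (x : cobar (M 0) n) : x = 0.
  elim: n x => [|n IH] x; last by apply: coindP => r; rewrite (IH (x r)).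
  by have [r ->] := residue_classP x; apply/residue_class0.
by move=> [x [_ _]]; rewrite (z _ x) => /(_ (coboundary0 _ _)).
Qed.

(** The statement for all T >= t is what makes the induction work: the classes
    reached from t = a + 1 live on R/J^a or directly on R/J^T, never on
    an intermediate power. *)
Lemma nonzero_class_grow t i j T : (t <= T)%N -> nonzero_class (M t) i j ->
  exists i' j', nonzero_class (M T) i' j' /\ i%:Z + j + ((T - t) * d)%:Z <= i'%:Z + j'.
Proof.
elim: t i j => [|a IH] i j tT; first by move/nonzero_class_unit.
have [n TE] : exists n, T = (a + n.+1)%N.
  by exists (T - a.+1)%N; rewrite addnS -addSn subnKC.
have aT : (a <= T)%N by exact: ltnW.
have Td : ((T - a) * d = (T - a.+1) * d + d)%N.
  by rewrite addnC -mulSn -subSn ?subSS.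
have nd : (n.+1 * d = (T - a) * d)%N by rewrite TE addnC addnK.
have base i0 j0 : nonzero_class (Q (ideal_pow I a.+1)) i0 j0 ->
    exists i' j', nonzero_class (M T) i' j' /\ i0%:Z - 1 + j0 + ((T - a) * d)%:Z <= i'%:Z + j'.
  move=> /(nonzero_class_base n)[j' jj [/(IH _ _ aT)[i1 [j1 [h le]]]|[i1 -> h]]].
    by exists i1, j1; split=> //; lia.
  by exists i1, (j' + (n.+1 * d)%:Z); split; [rewrite TE|lia].
(* Make the shift by d visible: the maps into R/J^(a+1) have degree d. *)
rewrite -[j in nonzero_class _ _ j](subrK d%:Z) => /(sq_exact_B (step_square a))[].
- by move=> /base[i' [j' [h le]]]; exists i', j'; split=> //; lia.
- by move=> /(IH _ _ aT)[i' [j' [h le]]]; exists i', j'; split=> //; lia.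
- by move=> /base[i' [j' [h le]]]; exists i', j'; split=> //; lia.
Qed.

End Powers.

(** * Depth and regularity *)

Section Invariants.
Context {k : fieldType} {R : posGradedAlg k}.

Lemma depth_le (M N : gradedMod R) :
  (forall i j, nonzero_class M i j -> exists j', nonzero_class N i j') ->
  (depth N <= depth M)%E.
Proof.
move=> H; apply: infimum_nat_le => i [j /lc_nonzeroP/H[j' h]].
by exists j'; apply/lc_nonzeroP.
Qed.

Lemma reg_le (M N : gradedMod R) (s t : int) :
  (forall i j, nonzero_class M i j -> exists i' j',
     nonzero_class N i' j' /\ i%:Z + j + (t - s) <= i'%:Z + j') ->
  (reg M - s%:E <= reg N - t%:E)%E.
Proof.
move=> H; rewrite /reg -!(image_comp (fun ij : nat * int => ij.1%:Z + ij.2) EFin).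
apply: supremum_int_le => _ [[i j] /lc_nonzeroP/H[i' [j' [h le]]] <-].
by exists (i'%:Z + j') => //; exists (i', j') => //; apply/lc_nonzeroP.
Qed.

End Invariants.

Theorem corollary5p4 (k : fieldType) (R : posGradedAlg k) (I : gradedIdeal R)
  (f : R) (d : nat) (hf : deg R d f)
  (hreg : forall t : nat, nonzerodivisor f (quotient_mod (ideal_pow I t))) :
  let M := fun t : nat =>
    quotient_mod (ideal_pow (ideal_add I (principal hf)) t) in
  (forall s t : nat, (1 <= s <= t)%N -> (depth (M t) <= depth (M s))%E) /\
  (forall s t : nat, (1 <= s <= t)%N ->
    (reg (M s) - (Posz (s * d))%:E <= reg (M t) - (Posz (t * d))%:E)%E).
Proof.
move=> M; split=> s t /andP[_ st].
  apply: depth_le => i j; rewrite -(subnKC st).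
  elim: (t - s)%N => [|n IH]; first by rewrite addn0; exists j.
  move=> /IH[j' h]; rewrite addnS.
  by case: (nonzero_class_succ hreg h) => h'; [exists j'|exists (j' + d%:Z)].
apply: reg_le => i j h; have [d0|d_gt0] := posnP d.
  exists i, j; split; last by lia.
  move: h; rewrite -(subnKC st); elim: (t - s)%N => [|n IH]; first by rewrite addn0.
  move=> /IH h; rewrite addnS; case: (nonzero_class_succ hreg h) => //.
  by rewrite (_ : j + d%:Z = j) //; lia.
have [i' [j' [h' le]]] := nonzero_class_grow hreg d_gt0 st h.
exists i', j'; split=> //; move: le; rewrite mulnBl.
have := leq_mul st (leqnn d); lia.
Qed.
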